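(* Let $d\ge2$, $k>1$ and $T=(1,2,\ldots,d-1,d^k,d-1,\ldots,2,1)$ ($d$ occurring $k$ times). A partition $P$ of diagonal lengths $T$ is a CIJT partition if and only if there exist an integer $0\le e\le d$ and an increasing sequence $0=a_0<a_1<\cdots<a_c=d-e$ (with $c=0$ if $e=d$) such that the branch label of $P$ is the concatenation $$\mathfrak b=(\mathfrak v,0,\mathfrak h_1,\ldots,\mathfrak h_c),$$ where $\mathfrak v$ is the (possibly empty) interval $\{x\in\mathbb Z: 1\le x\le e\}$ listed in increasing order, and for $i=1,\ldots,c$, $\mathfrak h_i$ is the interval $\{x\in\mathbb Z: d-a_i<x\le d-a_{i-1}\}$ listed in increasing order.
   Context: $\mathsf k$ is an infinite field of characteristic zero or of characteristic greater than $j:=2d+k-3$; $R=\mathsf k[x,y]$ with the standard grading. Here $T_i=i+1$ for $0\le i\le d-1$, $T_i=d$ for $d-1\le i\le d+k-2$, $T_i=j+1-i$ for $d+k-2\le i\le j$. The Ferrers diagram of a partition $P=(p_1\ge\cdots\ge p_s>0)$ has boxes $(r,c)$ with $1\le r\le s$, $1\le c\le p_r$ (rows counted from top, columns from left); box $(r,c)$ corresponds to the monomial $y^{r-1}x^{c-1}$. Diagonal lengths of $P$: $t_i$ is the number of boxes with $r+c-2=i$. For a graded Artinian quotient $A=R/I$ and a nonzero linear form $\ell$, $P_{\ell,A}$ is the partition of Jordan block sizes of multiplication by $\ell$ on $A$. $P$ of diagonal lengths $T$ is a CIJT partition if $P=P_{\ell,A}$ for some graded Artinian complete intersection $A=R/I$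 and some nonzero linear form $\ell$. Branch label. Let $P$ have diagonal lengths $T$, and let $s=\max\{0,k-2\}$. Its diagram contains the triangle $\Delta_d$ of all monomials of degree $\le d-1$. Let $e=\max\{i\in[0,d]: x^iy^{d-i}\text{ is not in the diagram of }P\}$. The branch label of $P$ is $\mathfrak b=(\mathfrak b(0),\ldots,\mathfrak b(d))$ with $\mathfrak b(e)=0$; for $i<e$, $\mathfrak b(i)=[\text{length of the }(i+1)\text{-st column of }P]-(d-i)-s$; for $i>e$, $\mathfrak b(i)=[\text{length of the }(i-e)\text{-th row of }P]-(d-i+e+1)-s$. (For $k>1$, $\mathfrak b$ is a permutation of $0,1,\ldots,d$.) *)

(* Defs.v *)
From mathcomp Require Import all_boot all_order all_algebra all_field.
From mathcomp Require Export mpoly.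

Set Implicit Arguments.
Unset Strict Implicit.
Unset Printing Implicit Defensive.

Import GRing.Theory.
Local Open Scope ring_scope.

Definition infinite_type (K : eqType) : Prop :=
  forall s : seq K, exists x : K, x \notin s.

(** * Partitions and their Ferrers diagrams *)

Definition is_partition (P : seq nat) : bool :=
  sorted geq P && all (fun p => 0 < p)%N P.

(* Rows and columns are numbered from 0: the box (r, c) of the diagram is
   the monomial x^c y^r, of degree r + c. *)
Definition in_diagram (P : seq nat) (r c : nat) : bool := (c < nth 0 P r)%N.

Definition boxes (P : seq nat) : seq (nat * nat) :=
  [seq (r, c) | r <- iota 0 (size P), c <- iota 0 (nth 0%N P r)].

Definition diagonal_length (P : seq nat) (i : nat) : nat :=
  count (fun b => b.1 + b.2 == i)%N (boxes P).

(* T = (1, 2, ..., d-1, d^k, d-1, ..., 2, 1) *)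
Definition Tseq (d k : nat) : seq nat :=
  iota 1 d.-1 ++ nseq k d ++ rev (iota 1 d.-1).

Definition has_diagonal_lengths (P T : seq nat) : Prop :=
  forall i : nat, diagonal_length P i = nth 0%N T i.

(** * Jordan type of a linear form on a graded complete intersection *)

Definition jordan_block (K : fieldType) (n : nat) : 'M[K]_n :=
  \matrix_(i, j) (i.+1 == j)%:R.

Definition jordan_mx (K : fieldType) (P : seq nat) :
    'M[K]_(\sum_(r < size P) nth 0%N P r) :=
  \mxdiag_(r < size P) jordan_block K (nth 0%N P r).

(* Some basis of V puts f in nilpotent Jordan form with blocks of sizes P.
   Only the eigenvalue 0 is considered: multiplication by an element of
   positive degree on a graded Artinian algebra is nilpotent. *)
Definition has_jordan_blocks (K : fieldType) (V : vectType K) (f : 'End(V))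
    (P : seq nat) : Prop :=
  exists e : (\sum_(r < size P) nth 0%N P r).-tuple V,
    basis_of fullv e /\
    forall i, f (tnth e i) = \sum_j jordan_mx K P i j *: tnth e j.

(* phi presents A as a quotient R/(f, g) of R = K[x, y] with f and g
   homogeneous. As A is an falgType it is finite-dimensional, i.e. Artinian,
   so (f, g) has codimension 2, the number of its generators. *)
Definition graded_CI_quotient (K : fieldType) (A : falgType K)
    (phi : {lrmorphism {mpoly K[2]} -> A}) : Prop :=
  (forall u : A, exists p, phi p = u) /\
  exists (f g : {mpoly K[2]}) (m n : nat),
    [/\ f \is m.-homog, g \is n.-homog &
        forall p, phi p = 0 <-> exists a b, p = a * f + b * g].

Definition CIJT (K : fieldType) (P : seq nat) : Prop :=
  exists (A : falgType K) (phi : {lrmorphism {mpoly K[2]} -> A})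
         (l : {mpoly K[2]}),
    [/\ graded_CI_quotient phi, l \is 1.-homog, l != 0 &
        has_jordan_blocks (amull (phi l)) P].

(** * Branch labels *)

Definition column_length (P : seq nat) (c : nat) : nat :=
  count (fun p => c < p)%N P.

(* max {i in [0, d] : x^i y^(d-i) is not in the diagram of P} *)
Definition branch_e (d : nat) (P : seq nat) : nat :=
  \max_(i < d.+1 | ~~ in_diagram P (d - i) i) i.

(* The (i+1)-st column has index i and the (i-e)-th row has index i - e - 1.
   The truncated subtraction k - 2 is max {0, k-2}. *)
Definition branch_entry (d k : nat) (P : seq nat) (i : nat) : int :=
  let e := branch_e d P in
  let s := (k - 2)%N in
  if (i < e)%N then (column_length P i)%:Z - (d - i)%N%:Z - s%:Z
  else if i == e then 0
  else (nth 0%N P (i - e).-1)%:Z - (d - i + e + 1)%N%:Z - s%:Z.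

Definition branch_label (d k : nat) (P : seq nat) : seq int :=
  mkseq (branch_entry d k P) d.+1.

(* {x : 1 <= x <= e} *)
Definition v_block (e : nat) : seq nat := index_iota 1 e.+1.

(* {x : d - a_i < x <= d - a_(i-1)}, for i >= 1 and a_i <= d *)
Definition h_block (d : nat) (a : nat -> nat) (i : nat) : seq nat :=
  index_iota (d - a i).+1 (d - a i.-1).+1.

(* Main.v *)
(* Multiplication by l on A = R/(f, g) is read off after setting l = 1 and
   writing z for a second coordinate. Let d <= m be the degrees of f and g, and
   F, G the dehomogenized generators, of degrees d - e and (if e > 0) m. The
   polynomials of degree r in z occur in the degree-t part of the ideal exactly
   when t >= r + n_r, and A has the Jordan strings l^b z_r (b < n_r), where z_r
   is homogeneous of degree r and monic in z. Hence n is the Jordan partition.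
   The Euclidean algorithm for F and G mod F, with remainders of degrees
   0 = a_0 < ... < a_c = d - e, bounds the degrees of Bezout coefficients and
   gives n_r = d + m - a_{i+1} - a_i for a_i <= r < a_{i+1}, then n_r = e up to
   r = m. Every sequence a arises, with quotients that are powers of z, and the
   diagonal lengths force m = d + k - 1. In terms of branch labels, each block
   of rows of equal length is one interval h_i and the e columns of length m
   are v. *)

From HB Require Import structures.
From Stdlib Require Import IndefiniteDescription.
Require Import Defs.
From mathcomp Require Import all_boot all_order all_algebra all_field.
From mathcomp Require Import zify ring.
Import GRing.Theory.

(** * Staircase partitions and branch labels *)

Lemma increasing_le c a : (forall i, (i < c) -> (a i < a i.+1)) ->
  forall i j, (i <= j <= c) -> (a i <= a j).
Proof.
move=> inc i; elim=> [|j IH] /andP[ij jc]; first by move: ij; rewrite leqn0 => /eqP->.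
move: ij; rewrite leq_eqVlt => /orP[/eqP-> //|ij].
by apply: leq_trans (IH _) (ltnW (inc _ jc)); rewrite -ltnS ij ltnW.
Qed.

Lemma staircase_index c a r : a 0 = 0 -> (r < a c) ->
  exists2 i, (i < c) & (a i <= r < a i.+1).
Proof.
move=> a0; elim: c => [|c IH]; first by rewrite a0.
move=> rc; case: (leqP (a c) r) => [cr|/IH[i ic ir]]; first by exists c; rewrite ?cr.
by exists i => //; rewrite ltnW.
Qed.

(** Appends [top] as the term of index [c.+1]: the degree gained when one more division is put in
    front of a Euclidean algorithm. *)
Definition extend_steps c a (top : nat) i : nat := if (i <= c) then a i else top.

Lemma extend_steps_increasing c a top :
  (forall i, (i < c) -> (a i < a i.+1)) -> (a c < top) ->
  forall i, (i < c.+1) -> (extend_steps c a top i < extend_steps c a top i.+1).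
Proof.
move=> inc act i; rewrite /extend_steps ltnS => ic; rewrite ic.
case: (leqP c i) => [ci|lt]; last exact: inc.
by have -> : i = c by apply/eqP; rewrite eqn_leq ic.
Qed.

Definition nonincreasing (P : seq nat) : Prop :=
  forall r, (nth 0 P r.+1 <= nth 0 P r).

Lemma is_partition_nonincreasing P : is_partition P -> nonincreasing P.
Proof.
case/andP=> /sortedP sP _ r; have [lt|le] := ltnP r.+1 (size P); first exact: sP.
by rewrite nth_default.
Qed.

Lemma lt_nth_column P c r : nonincreasing P ->
  (c < nth 0 P r) = (r < column_length P c).
Proof.
rewrite /column_length; elim: P r => [|p P IH] r niP; first by rewrite nth_nil.
have niP' : nonincreasing P by move=> i; apply: (niP i.+1).
have count0 : (p <= c) -> count (fun p => c < p) P = 0.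
  move=> pc; apply/eqP; rewrite -leqn0 leqNgt -IH // -leqNgt.
  exact: leq_trans (niP 0) pc.
case: r => [|r] /=; first by case: (ltnP c p) => // /count0->.
rewrite IH //; case: (ltnP c p) => [_|/count0->]; last by rewrite !ltn0.
by rewrite add1n ltnS.
Qed.

(* The rows of the diagram: a_0 < ... < a_c are the degrees of the remainders
   in the Euclidean algorithm for the dehomogenized generators, of degrees
   d - e and (if e > 0) m. *)
Definition stair_function (d m e c : nat) (a n : nat -> nat) : Prop :=
  [/\ forall i r, (i < c) -> (a i <= r < a i.+1) ->
        n r = (d + m - a i.+1 - a i),
      forall r, (d - e <= r < m) -> n r = e &
      forall r, (m <= r) -> n r = 0].

(** With $\phi(x)=x(s-x)$, a block of $y-x$ rows of length $s-x-y$ has area $\phi(y)-\phi(x)$, so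
    the areas of consecutive blocks telescope. *)
Lemma telescope_step x y s : x <= y -> x + y <= s ->
  x * (s - x) + (y - x) * (s - y - x) = y * (s - y).
Proof.
move=> xy xys; have := subnKC xy; have := subnKC xys.
move: (y - x) (s - (x + y)) => t v <- <-.
have -> : x + (x + t) + v - x = x + t + v by lia.
have -> : x + (x + t) + v - (x + t) = x + v by lia.
have -> : x + v - x = v by lia.
ring.
Qed.

Lemma rectangle_area d e m : e <= d -> d <= m ->
  (d - e) * (d + m - (d - e)) + (m - (d - e)) * e = d * m.
Proof.
move=> ed dm; have := subnKC ed; have := subnKC dm.
move: (d - e) (m - d) => b w <- <-.
have -> : e + b + (e + b + w) - b = e + (e + b + w) by lia.
have -> : e + b + w - b = e + w by lia.
ring.
Qed.

Lemma sum_interval (x y m v : nat) : y <= m ->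
  \sum_(r < m | x <= r < y) v = (y - x) * v.
Proof.
(* Truncating the right endpoint to [minn y m] makes the formula valid for every [m], so that
   induction on [m] applies. *)
move=> ym; rewrite -{2}(minn_idPl ym) => {ym}; rewrite big_mkcond /=.
elim: m => [|m IH]; first by rewrite big_ord0 minn0.
rewrite big_ord_recr /= IH; case: ifP => ?; last by rewrite addn0; congr (_ * v); lia.
by rewrite addnC -mulSn; congr (_ * v); lia.
Qed.

Section StairRow.
Variables (d m e c : nat) (a : nat -> nat).
Hypotheses (ed : (e <= d)) (dm : (d <= m)).
Hypotheses (a0 : a 0 = 0) (inc : forall i, (i < c) -> (a i < a i.+1)).
Hypothesis ac : a c = d - e.

(** The blocks are disjoint, so at most one term survives; the form as a sum lets the area be
    computed by exchanging summations. *)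
Definition stair_row (r : nat) : nat :=
  \sum_(i < c | a i <= r < a i.+1) (d + m - a i.+1 - a i) +
  (if d - e <= r < m then e else 0).

Let steps_le i : (i <= c) -> (a i <= d - e).
Proof. by move=> ic; rewrite -ac; apply: (@increasing_le c a inc); rewrite ic leqnn. Qed.

Lemma stair_row_function : stair_function d m e c a stair_row.
Proof.
split=> [i r ic /andP[ir ri]|r rr|r mr].
- have aic := steps_le _ ic.
  rewrite /stair_row ifN ?addn0; last by rewrite negb_and -ltnNge (leq_trans ri).
  rewrite (bigD1 (Ordinal ic)) /= ?ir ?ri // big1 ?addn0 // => j /andP[/andP[jr rj]].
  rewrite -val_eqE /= neq_ltn => /orP[ji|ij].
    suff : (a j.+1 <= a i) by lia.
    by apply: (@increasing_le c a inc); rewrite ji ltnW.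
  suff : (a i.+1 <= a j) by lia.
  by apply: (@increasing_le c a inc); rewrite ij ltnW.
- rewrite /stair_row rr big_pred0 // => i.
  by have := steps_le _ (ltn_ord i); lia.
- rewrite /stair_row big_pred0; first by case: ifP; lia.
  by move=> i; have := steps_le _ (ltn_ord i); lia.
Qed.

Variable n : nat -> nat.
Hypothesis nP : stair_function d m e c a n.

Lemma stair_function_row r : n r = stair_row r.
Proof.
have [n1 n2 n3] := nP; have [s1 s2 s3] := stair_row_function.
have [rc|rc] := ltnP r (a c).
  by have [i ic ir] := staircase_index _ _ _ a0 rc; rewrite (n1 i) // (s1 i).
by have [rm|mr] := ltnP r m; [rewrite n2 ?s2 // -ac rc | rewrite n3 ?s3].
Qed.

Lemma stair_function_nonincreasing r : (n r.+1 <= n r).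
Proof.
have [n1 n2 n3] := nP.
have [rm|mr] := ltnP r.+1 m; last by rewrite n3.
have [rc|rc] := ltnP r.+1 (a c); last first.
  rewrite n2; last by rewrite -ac rc.
  have [rc'|rc'] := ltnP r (a c); last by rewrite n2 // -ac rc'; lia.
  have [i ic ir] := staircase_index _ _ _ a0 rc'; rewrite (n1 i) //.
  by have := steps_le _ ic; have := steps_le _ (ltnW ic); lia.
have [i ic ir] := staircase_index _ _ _ a0 rc; rewrite (n1 i r.+1) //.
have [air|air] := leqP (a i) r; first by rewrite (n1 i) //; lia.
case: i ic ir air => [|i] ic ir air; first by rewrite a0 in air.
rewrite (n1 i r); [|exact: ltnW|]; have := inc _ ic; have := inc _ (ltnW ic); lia.
Qed.

Lemma stair_function_degree r b : (b < n r) -> (r + b < d + m - 1).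
Proof.
have [n1 n2 n3] := nP => bn.
have [rc|rc] := ltnP r (a c).
  have [i ic ir] := staircase_index _ _ _ a0 rc; move: bn; rewrite (n1 i) //.
  by have := steps_le _ ic; lia.
have [rm|mr] := ltnP r m; last by move: bn; rewrite n3.
by move: bn; rewrite n2 -?ac ?rc //; lia.
Qed.

(** The box is the end of the last row of the first block or, when [c = 0], the corner of an
    $m\times d$ rectangle. With [stair_function_degree] it identifies $d+m-2$ as the top degree. *)
Lemma stair_function_top : (0 < d) -> exists r b, (b < n r) /\ (r + b).+2 = d + m.
Proof.
have [n1 n2 n3] := nP => d0; case: (posnP c) => [c0|c0].
  have de : e = d by move: ac; rewrite c0 a0; lia.
  by exists m.-1, d.-1; rewrite n2; lia.
have a1 := inc _ c0; have a1d := steps_le _ c0.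
exists (a 1).-1, (d + m - a 1 - 1); rewrite (n1 0) //; lia.
Qed.

Let partial_sum c' : (c' <= c) ->
  \sum_(i < c') (a i.+1 - a i) * (d + m - a i.+1 - a i) = a c' * (d + m - a c').
Proof.
elim: c' => [|c' IH] cc; first by rewrite big_ord0 a0.
rewrite big_ord_recr /= IH; last exact: ltnW.
have := inc _ cc; have := steps_le _ cc => le lt.
by apply: telescope_step; lia.
Qed.

Lemma stair_function_sum : \sum_(r < m) n r = d * m.
Proof.
under eq_bigr do rewrite stair_function_row; rewrite big_split /= (exchange_big_dep xpredT) //=.
under eq_bigr => i _ do
  rewrite sum_interval ?(leq_trans (steps_le _ (ltn_ord i))) ?(leq_trans _ dm) ?leq_subr //.
rewrite partial_sum // ac -big_mkcond sum_interval //.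
exact: rectangle_area.
Qed.

End StairRow.

(** * Number of boxes and top degree read off from the diagonal lengths *)

Lemma mem_boxes P r c : ((r, c) \in boxes P) = (c < nth 0 P r).
Proof.
apply/allpairsPdep/idP => [[r' [c' [_ + [-> ->]]]]|lt].
  by rewrite mem_iota.
exists r, c; rewrite !mem_iota /= add0n; split=> //.
by rewrite ltnNge; apply/negP => le; rewrite nth_default in lt.
Qed.

Lemma size_boxes P : size (boxes P) = sumn P.
Proof.
rewrite size_allpairs_dep -{3}(mkseq_nth 0 P) /mkseq; congr sumn.
by apply: eq_map => r; rewrite size_iota.
Qed.

Lemma sumn_count_levels (T : Type) (deg : T -> nat) (s : seq T) N :
  all (fun b => deg b < N) s ->
  \sum_(i < N) count (fun b => deg b == i) s = size s.
Proof.
elim: s => [|b s IH] /=; first by rewrite big1.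
case/andP=> bN /IH {}IH; rewrite big_split /= IH (bigD1 (Ordinal bN)) //= eqxx.
by rewrite big1 // => i; rewrite -val_eqE /= eq_sym => /negbTE->.
Qed.

Lemma sumn_nth_widen P N : size P <= N -> \sum_(r < N) nth 0 P r = sumn P.
Proof.
move=> PN; rewrite sumnE (big_nth 0) big_mkord (big_ord_widen _ _ PN) [RHS]big_mkcond.
by apply: eq_bigr => r _; case: ltnP => // /(nth_default 0).
Qed.

Lemma sumn_iota1 n : (sumn (iota 1 n)).*2 = n * n.+1.
Proof.
elim: n => // n IH; rewrite -(addn1 n) iotaD sumn_cat /= doubleD IH; lia.
Qed.

Lemma size_Tseq d k : size (Tseq d k) = d.-1 + k + d.-1.
Proof. by rewrite !size_cat size_rev !size_iota size_nseq addnA. Qed.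

Lemma sumn_Tseq d k : sumn (Tseq d k) = d * (d + k - 1).
Proof.
rewrite !sumn_cat sumn_nseq sumn_rev; have := sumn_iota1 d.-1.
case: d => [|d] /=; first by lia.
rewrite addnCA addnn => ->; rewrite -addn1; nia.
Qed.

Lemma Tseq_gt0 d k i : 0 < d -> (0 < nth 0 (Tseq d k) i) = (i < d.-1 + k + d.-1).
Proof.
move=> d0; rewrite -size_Tseq; case: (ltnP i) => [lt|le]; last by rewrite nth_default.
have /allP-> // : all (fun t => 0 < t) (Tseq d k); last exact: mem_nth.
by rewrite !all_cat all_rev all_nseq d0 orbT /=; apply/andP; split;
   apply/allP => t; rewrite mem_iota => /andP[].
Qed.

Section DiagonalLengths.
Variables (d k : nat) (P : seq nat).
Hypotheses (d0 : 0 < d) (k0 : 0 < k) (PT : has_diagonal_lengths P (Tseq d k)).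

Lemma diagonal_degree r c : c < nth 0 P r -> r + c < d + (d + k - 1) - 1.
Proof.
rewrite -mem_boxes => rc.
have : 0 < diagonal_length P (r + c).
  by rewrite -has_count; apply/hasP; exists (r, c).
by rewrite PT Tseq_gt0 //; lia.
Qed.

Lemma diagonal_top : exists r c, c < nth 0 P r /\ (r + c).+2 = d + (d + k - 1).
Proof.
have : 0 < diagonal_length P (d + (d + k - 1) - 2) by rewrite PT Tseq_gt0 //; lia.
rewrite -has_count => /hasP[[r c]]; rewrite mem_boxes /= => rc /eqP e.
by exists r, c; split=> //; lia.
Qed.

Lemma diagonal_sum : sumn P = d * (d + k - 1).
Proof.
rewrite -sumn_Tseq -(@sumn_nth_widen (Tseq d k) (d + (d + k - 1) - 1)); last first.
  by rewrite size_Tseq; lia.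
rewrite -size_boxes -(@sumn_count_levels _ (fun b => b.1 + b.2) _ (d + (d + k - 1) - 1)).
  by apply: eq_bigr => i _; rewrite -PT.
by apply/allP => -[r c]; rewrite mem_boxes; apply: diagonal_degree.
Qed.

End DiagonalLengths.

(** The top degree of a box gives $d'+m'$ and the number of boxes gives $d'm'$. Since $d'\le m'$ and
    $d\le d+k-1$, sum and product determine the ordered pair. *)
Lemma stair_parameters d k P d' m' e c a :
  0 < d -> 1 < k -> has_diagonal_lengths P (Tseq d k) ->
  0 < d' -> e <= d' -> d' <= m' -> a 0 = 0 -> (forall i, i < c -> a i < a i.+1) ->
  a c = d' - e -> stair_function d' m' e c a (nth 0 P) ->
  d' = d /\ m' = d + k - 1.
Proof.
move=> d0 k1 PT d'0 ed' dm' a0 inc ac st.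
have k0 : 0 < k by apply: ltnW.
have s1 : d' + m' = d + (d + k - 1).
  have [r [b [/(diagonal_degree _ _ _ d0 k0 PT) lt eq]]] :=
    stair_function_top _ _ _ _ _ ed' dm' a0 inc ac _ st d'0.
  have [r' [b' [/(stair_function_degree _ _ _ _ _ ed' dm' a0 inc ac _ st) lt' eq']]] :=
    diagonal_top _ _ _ d0 k0 PT.
  lia.
have s2 : d' * m' = d * (d + k - 1).
  rewrite -(diagonal_sum _ _ _ d0 k0 PT).
  rewrite -(stair_function_sum _ _ _ _ _ ed' dm' a0 inc ac _ st).
  have sP : size P <= maxn (size P) m' by apply: leq_maxl.
  rewrite -(sumn_nth_widen _ _ sP) (big_ord_widen _ (fun r => nth 0 P r) (leq_maxr (size P) m')).
  rewrite big_mkcond; apply: eq_bigr => r _; case: ltnP => // mr.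
  by have [_ _ ->] := st.
have mE : exists w, m' = d' + w by exists (m' - d'); lia.
case: mE => w mE; nia.
Qed.

(** * Branch labels of staircase diagrams *)

Lemma size_flatten_h_blocks d c a : a 0 = 0 -> (forall i, i < c -> a i < a i.+1) -> a c <= d ->
  size (flatten [seq h_block d a i | i <- iota 1 c]) = a c.
Proof.
move=> a0; elim: c => [|c IH] inc acd; first by rewrite a0.
have lt := inc c (leqnn _).
have inc' j : j < c -> a j < a j.+1 by move=> jc; apply: inc; apply: ltnW.
rewrite -(addn1 c) iotaD map_cat flatten_cat size_cat IH //; last by lia.
by rewrite /= cats0 size_iota add1n addn1 /=; lia.
Qed.

(** The block of index $i+1$ has $a_{i+1}-a_i$ entries and so starts at place $a_i$; [a c <= d]
    keeps the subtractions from truncating. *)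
Lemma nth_flatten_h_blocks d c a i r : a 0 = 0 -> (forall i, i < c -> a i < a i.+1) ->
  a c <= d -> i < c -> a i <= r < a i.+1 ->
  nth 0 (flatten [seq h_block d a i | i <- iota 1 c]) r = (d - a i.+1).+1 + (r - a i).
Proof.
move=> a0; elim: c => // c IH inc acd ic ir.
have lt := inc c (leqnn _).
have inc' j : j < c -> a j < a j.+1 by move=> jc; apply: inc; apply: ltnW.
have acd' : a c <= d by lia.
rewrite -(addn1 c) iotaD map_cat flatten_cat nth_cat size_flatten_h_blocks //.
move: ic; rewrite ltnS leq_eqVlt => /orP[/eqP e|ic].
  move: ir; rewrite e => ir; rewrite ltnNge (andP ir).1 /= cats0 add1n /h_block /=.
  by rewrite nth_iota //; lia.
rewrite ifT ?IH //.
by have : a i.+1 <= a c by [apply: (@increasing_le c a inc'); lia]; lia.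
Qed.

Section BranchLabel.
Variables (d k e c : nat) (a : nat -> nat) (P : seq nat).
Hypotheses (d0 : 0 < d) (k1 : 1 < k) (niP : nonincreasing P).
Hypotheses (ed : e <= d) (a0 : a 0 = 0) (inc : forall i, i < c -> a i < a i.+1).
Hypothesis ac : a c = d - e.

Let label := v_block e ++ 0 :: flatten [seq h_block d a i | i <- iota 1 c].
Local Notation m := (d + k - 1).

Let acd : a c <= d. Proof. by rewrite ac leq_subr. Qed.

Let dm : d <= m. Proof. lia. Qed.

Let steps_le i : (i <= c) -> (a i <= d - e).
Proof. by move=> ic; rewrite -ac; apply: (@increasing_le c a inc); rewrite ic leqnn. Qed.

Let size_label : size label = d.+1.
Proof. by rewrite size_cat size_iota /= size_flatten_h_blocks // ac; lia. Qed.

Let label_v i : i < e -> nth 0 label i = i.+1.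
Proof. by move=> ie; rewrite nth_cat size_iota subn1 ie nth_iota ?add1n //; lia. Qed.

Let label_0 : nth 0 label e = 0.
Proof. by rewrite nth_cat size_iota subn1 ltnn subnn. Qed.

Let label_h q r : q < c -> a q <= r < a q.+1 ->
  nth 0 label (e + r.+1) = (d - a q.+1).+1 + (r - a q).
Proof.
move=> qc qr; rewrite nth_cat size_iota subn1 ltnNge leq_addr /= addKn /=.
exact: nth_flatten_h_blocks.
Qed.

Lemma stair_branch_label : stair_function d m e c a (nth 0 P) ->
  branch_label d k P = map Posz label.
Proof.
move=> st; have [n1 n2 n3] := st.
(* For $e<i\le d$ the row $d-i$ lies in a block and is longer than $i$ because $m>d$, while row
   $d-e$ has length exactly $e$. *)
have be : branch_e d P = e.
  apply/eqP; rewrite eqn_leq; apply/andP; split.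
    apply/bigmax_leqP => i; rewrite /in_diagram; apply: contraNleq => ei.
    have id := ltn_ord i.
    have rc : d - i < a c by rewrite ac; lia.
    have [q qc qr] := staircase_index _ _ _ a0 rc; rewrite (n1 q) //.
    by have := steps_le _ qc; lia.
  have ed1 : e < d.+1 by [].
  apply: (@leq_bigmax_cond _ _ _ (Ordinal ed1)).
  by rewrite /in_diagram /= n2 ?ltnn //; lia.
have col i : i < e -> column_length P i = m.
  move=> ie; have h r : (r < m) = (r < column_length P i).
    rewrite -lt_nth_column //.
    have [rc|rc] := ltnP r (a c).
      have [q qc qr] := staircase_index _ _ _ a0 rc; rewrite (n1 q) //.
      by have := steps_le _ qc; have := steps_le _ (ltnW qc); lia.
    have [rm|mr] := ltnP r m; last by rewrite n3.
    by rewrite n2 ?ie // -ac rc.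
  by apply/eqP; rewrite eqn_leq leqNgt -h ltnn leqNgt h ltnn.
apply: (@eq_from_nth _ 0%R) => [|i]; rewrite size_mkseq ?size_map ?size_label // => id.
rewrite nth_mkseq // (nth_map 0) ?size_label // /branch_entry be.
case: ltngtP => [ie|ei|->]; last by rewrite label_0.
  by rewrite col // label_v //; lia.
(* As $m=d+k-1$, subtracting $(d-r)+(k-2)$ from the row length $d+m-a_{q+1}-a_q$ leaves
   $(d-a_{q+1})+1+(r-a_q)$, the entry of the block. *)
have [r ir] : exists r, i = e + r.+1 by exists (i - e).-1; lia.
have rc : r < a c by rewrite ac; lia.
have [q qc qr] := staircase_index _ _ _ a0 rc.
rewrite ir (label_h q) // addKn /= (n1 q) //.
by have := steps_le _ qc; have := steps_le _ (ltnW qc); lia.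
Qed.

(** The label prescribes only the first $d-e$ rows and the first $e$ columns. These make the diagram
    contain the staircase, and equality of areas forces equality in every row. *)
Lemma branch_label_stair : sumn P = d * m ->
  branch_label d k P = map Posz label -> stair_function d m e c a (nth 0 P).
Proof.
move=> sP bl.
have entry i : i <= d -> branch_entry d k P i = Posz (nth 0 label i).
  move=> id; have := congr1 (fun s => nth 0%R s i) bl.
  by rewrite nth_mkseq // (nth_map 0) ?size_label.
have bed : branch_e d P <= d by apply/bigmax_leqP => i _; rewrite -ltnS.
(* The entry at [branch_e d P] is 0, and the proposed label vanishes only at position [e]. *)
have be : branch_e d P = e.
  have := entry _ bed; rewrite /branch_entry ltnn eqxx.
  case: (ltngtP (branch_e d P) e) => // [lt|gt]; first by rewrite label_v.
  have [r ir] : exists r, branch_e d P = e + r.+1 by exists (branch_e d P - e).-1; lia.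
  have rc : r < a c by rewrite ac; lia.
  have [q qc qr] := staircase_index _ _ _ a0 rc.
  by rewrite ir (label_h q).
have rows r : stair_row d m e c a r <= nth 0 P r.
  have [s1 s2 s3] := stair_row_function _ _ _ _ _ ed dm a0 inc ac.
  have [rc|rc] := ltnP r (a c).
    have [q qc qr] := staircase_index _ _ _ a0 rc; rewrite (s1 q) //.
    have id : e + r.+1 <= d by rewrite ac in rc; lia.
    have := entry _ id; rewrite /branch_entry be (label_h q) // addKn.
    rewrite ltnNge leq_addr /= ifF; last by apply/eqP; lia.
    by have := steps_le _ qc; have := steps_le _ (ltnW qc); lia.
  have [rm|mr] := ltnP r m; last by rewrite s3.
  (* Column [e.-1] alone suffices: its length is [m], so each of the first [m] rows has at least [e]
     boxes. *)
  rewrite s2 -?ac ?rc //; case: (posnP e) => [-> //|e0].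
  have ie : e.-1 < e by rewrite prednK.
  have id : e.-1 <= d by lia.
  have := entry _ id; rewrite /branch_entry be ie label_v // => colE.
  have : r < column_length P e.-1 by lia.
  by rewrite -lt_nth_column // prednK.
have st := stair_row_function _ _ _ _ _ ed dm a0 inc ac.
have eqrow r : nth 0 P r = stair_row d m e c a r.
  pose N := (maxn (size P) (maxn m r.+1)).
  have sumP : \sum_(r < N) nth 0 P r = d * m by rewrite sumn_nth_widen ?leq_maxl.
  have sumS : \sum_(r < N) stair_row d m e c a r = d * m.
    rewrite -(stair_function_sum _ _ _ _ _ ed dm a0 inc ac _ st).
    have mN : m <= N by rewrite /N; lia.
    rewrite [RHS](big_ord_widen _ _ mN) [RHS]big_mkcond.
    by apply: eq_bigr => i _; case: ltnP => // mi; have [_ _ ->] := st.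
  have rN : r < N by rewrite /N; lia.
  move: sumP; rewrite -sumS (bigD1 (Ordinal rN)) //= [RHS](bigD1 (Ordinal rN)) //=.
  have cancel A B C D : A + B = C + D -> C <= A -> D <= B -> A = C by lia.
  by move/cancel; apply; [apply: rows | apply: leq_sum].
by have [s1 s2 s3] := st; split=> *; rewrite eqrow; [apply: s1 | apply: s2 | apply: s3].
Qed.

End BranchLabel.

Local Open Scope ring_scope.

(** * Degrees in the Euclidean algorithm *)

Section Staircase.
Variable K : fieldType.
Implicit Types (F G Q u v w : {poly K}) (c r i : nat) (a : nat -> nat).

Lemma size_mulf u v : u != 0 -> v != 0 -> size (u * v)%R = (size u + size v).-1.
Proof. exact: size_mul. Qed.

Lemma size_mulf_leq u v : (size (u * v)%R <= (size u + size v).-1)%N.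
Proof. exact: size_polyMleq. Qed.

Lemma size_subf_leq u v : (size (u - v)%R <= maxn (size u) (size v))%N.
Proof. by rewrite -(size_polyN v) size_polyD. Qed.

(* Here 0 = a_0 < ... < a_c = deg F are the degrees of the successive remainders
   of F by G: the second Bezout coefficient of a combination of degree r, with
   a_i <= r < a_{i+1}, has degree at least (a_c - a_{i+1}) + (r - a_i), and this
   bound is attained. *)
Definition staircase F G c a : Prop :=
  forall i r, (i < c)%N -> (a i <= r < a i.+1)%N ->
    (exists u v, [/\ u * F + v * G \is monic, size (u * F + v * G) = r.+1 &
                    (size v <= (a c - a i.+1 + (r - a i)).+1)%N]) /\
    (forall u v, size (u * F + v * G) = r.+1 ->
       (a c - a i.+1 + (r - a i) < size v)%N).

Lemma eq_staircase F G c a b :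
  (forall i, (i <= c)%N -> a i = b i) -> staircase F G c a -> staircase F G c b.
Proof.
move=> eab st i r ic; rewrite -!eab ?(ltnW ic) // => ar; exact: st.
Qed.

Lemma size_polyDr_lt u v : (size u < size v)%N -> size (u + v) = size v.
Proof. by move=> ?; rewrite addrC size_polyDl. Qed.

(** The leading terms of the two products have to cancel. This transfers degree bounds between the
    two Bezout coefficients. *)
Lemma size_combination_lt u v F G :
  (size (u * F + v * G)%R < size (u * F)%R)%N -> size (v * G)%R = size (u * F)%R.
Proof.
move=> lt; have -> : v * G = (u * F + v * G) - u * F by rewrite [u * F + _]addrC addrK.
by rewrite size_polyDr_lt size_polyN.
Qed.

(** A Euclidean division read backwards: $QF+G$ divided by $F$ leaves $G$. Combinations of $F$ and
    $G$ are those of $QF+G$ and $F$, which settles the old steps; the new step $a_c\le r<a_c+\deg Q$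
    is reached by multiples of $F$ alone. *)
Lemma staircase_step F G Q c a :
  Q != 0 -> (1 < size Q)%N -> (forall i, (i < c)%N -> (a i < a i.+1)%N) ->
  size F = (a c).+1 -> (size G < size F)%N -> staircase F G c a ->
  staircase (Q * F + G) F c.+1 (extend_steps c a (a c + (size Q).-1)).
Proof.
move=> Q0 sQ inc sF sG st.
have F0 : F != 0 by rewrite -size_poly_eq0 sF.
have sQF : size (Q * F) = (a c + size Q)%N by rewrite size_mulf // sF; lia.
have sF' : size (Q * F + G) = (a c + size Q)%N.
  by rewrite size_polyDl // sQF; lia.
have F'0 : Q * F + G != 0 by rewrite -size_poly_eq0 sF'; lia.
set F' := Q * F + G in sF' F'0 *.
move=> i r; rewrite ltnS leq_eqVlt => /orP[/eqP->|ic]; last first.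
  rewrite {1}/extend_steps (ltnW ic) {1}/extend_steps ic => ir.
  rewrite /extend_steps ltnn (ltnW ic) ic.
  have aic : (a i.+1 <= a c)%N by apply: (@increasing_le c a inc); rewrite ic leqnn.
  have [[U [V [mw sw sV]]] low] := st i r ic ir.
  split.
    (* Substituting $G=F'-QF$ turns the coefficients $(U,V)$ into $(V,U-VQ)$. *)
    exists V, (U - V * Q).
    have -> : V * F' + (U - V * Q) * F = U * F + V * G by rewrite /F'; ring.
    split=> //; apply: leq_trans (size_subf_leq _ _) _; rewrite geq_max.
    apply/andP; split.
      case: (eqVneq U 0) => [->|U0]; first by rewrite size_poly0.
      (* Since $\deg G<\deg F$, writing $UF$ as the combination minus $VG$ shows that [U] has at
         most the size of [V]. *)
      have : (size (U * F)%R <= maxn (a c) (size V + a c))%N.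
        have -> : U * F = (U * F + V * G) - V * G by rewrite addrK.
        apply: leq_trans (size_subf_leq _ _) _; rewrite sw.
        have := size_mulf_leq V G; move: ir sG; rewrite sF; lia.
      by rewrite size_mulf // sF; move: sV; lia.
    by apply: leq_trans (size_mulf_leq _ _) _; lia.
  (* Here [u] is the second coefficient for [F] and [G], to which the old bound applies;
     cancellation of leading terms gives $\deg v=\deg u+\deg Q$. *)
  move=> u v suv.
  have e : u * F' + v * F = (u * Q + v) * F + u * G by rewrite /F'; ring.
  have := low (u * Q + v) u; rewrite -e => /(_ suv) su.
  have u0 : u != 0 by rewrite -size_poly_eq0; lia.
  have suF : size (u * F') = (size u + a c + (size Q).-1)%N.
    by rewrite size_mulf // sF'; lia.
  have svF : size (v * F) = size (u * F').
    by apply: size_combination_lt; rewrite suv suF; lia.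
  have v0 : v != 0.
    by apply/eqP=> v0; move: svF; rewrite v0 mul0r size_poly0 suF; lia.
  by move: svF; rewrite size_mulf // sF suF; lia.
rewrite {1}/extend_steps leqnn {1}/extend_steps ltnn => ir.
rewrite /extend_steps ltnn leqnn subnn add0n.
split.
  exists 0, ((lead_coef F)^-1 *: 'X^(r - a c)); rewrite mul0r add0r -scalerAl.
  have lF : lead_coef F != 0 by rewrite lead_coef_eq0.
  split.
  - by rewrite monicE lead_coefZ lead_coefM lead_coefXn mul1r mulVf.
  - by rewrite size_scale ?invr_eq0 // size_monicM ?monicXn // size_polyXn sF; lia.
  - by rewrite size_scale ?invr_eq0 // size_polyXn; lia.
(* If $u=0$ then $\deg v=r-a_c$ exactly; otherwise cancellation gives $\deg v\ge\deg Q>r-a_c$. *)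
move=> u v sw; have [u0|u0] := eqVneq u 0.
  have v0 : v != 0.
    by apply/eqP => v0; move: sw; rewrite u0 v0 !mul0r addr0 size_poly0.
  by move: sw; rewrite u0 mul0r add0r size_mulf // sF; lia.
have su : (0 < size u)%N by rewrite size_poly_gt0.
have suF : size (u * F') = (size u + a c + (size Q).-1)%N.
  by rewrite size_mulf // sF'; lia.
have svF : size (v * F) = size (u * F').
  by apply: size_combination_lt; rewrite sw suF; lia.
have v0 : v != 0.
  by apply/eqP=> v0; move: svF; rewrite v0 mul0r size_poly0 suF; lia.
by move: svF; rewrite size_mulf // sF suF; lia.
Qed.

Lemma euclid_staircase F G : coprimep F G -> (size G < size F)%N ->
  exists c a, [/\ a 0%N = 0%N, (forall i, (i < c)%N -> (a i < a i.+1)%N),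
    size F = (a c).+1 & staircase F G c a].
Proof.
elim/ltn_ind: {F}(size F) {-2}F (erefl (size F)) G => s IH F sF G co sG.
(* When $G=0$, coprimality makes $F$ a nonzero constant, so there are no steps. *)
have [G0|G0] := eqVneq G 0.
  exists 0%N, (fun=> 0%N); split=> //.
  by move: co; rewrite G0 coprimep0 -size_poly_eq1 => /eqP.
have sG0 : (0 < size G)%N by rewrite size_poly_gt0.
have coM : coprimep G (F %% G) by rewrite coprimep_sym coprimep_modl.
have [c [a [a0 inc sGa st]]] := IH (size G) (eq_ind _ (fun n => (size G < n)%N) sG _ sF)
  G (erefl _) (F %% G) coM (ltn_modpN0 F G0).
have sQ : size (F %/ G) = (size F - (size G).-1)%N by rewrite size_divp.
have Q0 : F %/ G != 0 by rewrite -size_poly_eq0 sQ; lia.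
exists c.+1, (extend_steps c a (a c + (size (F %/ G)).-1)); split.
- by rewrite /extend_steps leq0n.
- by apply: extend_steps_increasing => //; rewrite sQ; lia.
- by rewrite /extend_steps ltnn sQ; lia.
- rewrite {1}(divp_eq F G); apply: staircase_step => //; first by rewrite sQ; lia.
  exact: ltn_modpN0.
Qed.

(** The Euclidean algorithm is run backwards from the pair $(1,0)$, with quotient $X^{a_{c+1}-a_c}$
    at each step. *)
Lemma staircase_exists c a : a 0%N = 0%N ->
  (forall i, (i < c)%N -> (a i < a i.+1)%N) ->
  exists F G, [/\ F \is monic, size F = (a c).+1, (size G < size F)%N,
    coprimep F G & staircase F G c a].
Proof.
move=> a0; elim: c => [|c IH] inc.
  exists 1, 0; rewrite a0 size_poly1 size_poly0 coprimep0 eqpxx monic1; split=> //.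
have [F [G [mF sF sG co st]]] := IH (fun i ic => inc i (ltnW ic)).
have acS := inc c (leqnn _).
have F0 := monic_neq0 mF.
have mQ : 'X^(a c.+1 - a c) \is @monic K by apply: monicXn.
have sQ : size ('X^(a c.+1 - a c) : {poly K}) = (a c.+1 - a c).+1 by rewrite size_polyXn.
have sQF : size ('X^(a c.+1 - a c) * F) = (a c.+1).+1.
  by rewrite size_monicM // sQ sF; lia.
have lt : (size G < size ('X^(a c.+1 - a c) * F)%R)%N by rewrite sQF; move: sG; rewrite sF; lia.
exists ('X^(a c.+1 - a c) * F + G), F; split.
- by rewrite monicE lead_coefDl // lead_coefM lead_coefXn mul1r -monicE.
- by rewrite size_polyDl.
- by rewrite size_polyDl // sQF sF; lia.
- by rewrite coprimep_sym coprimep_addl_mul.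
apply: (@eq_staircase _ _ _ (extend_steps c a (a c + (a c.+1 - a c).+1.-1))).
  move=> i; rewrite /extend_steps leq_eqVlt => /orP[/eqP->|]; first by rewrite ltnn; lia.
  by rewrite ltnS => ->.
rewrite -sQ; apply: staircase_step => //.
- exact: monic_neq0.
- by rewrite sQ; lia.
- by move=> i ic; apply: inc; apply: ltnW.
Qed.

End Staircase.

(** * Degrees of polynomials in the graded parts of the ideal *)

Section GradedPiece.
Variables (K : fieldType) (F G : {poly K}) (d m : nat).
Implicit Types (u v w Z : {poly K}).

(* The degree-t part of the homogeneous ideal (f, g), where deg f = d and
   deg g = m, after setting l = 1. *)
Definition graded_piece (t : nat) w : Prop :=
  exists u v, [/\ w = u * F + v * G, (size u <= t.+1 - d)%N & (size v <= t.+1 - m)%N].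

Variables (e c : nat) (a n : nat -> nat).
Hypotheses (ed : (e <= d)%N) (dm : (d <= m)%N).
Hypotheses (sF : size F = (d - e).+1) (sG : (size G <= m.+1)%N).
Hypothesis sGe : (0 < e)%N -> size G = m.+1.
Hypotheses (a0 : a 0%N = 0%N) (inc : forall i, (i < c)%N -> (a i < a i.+1)%N).
Hypotheses (ac : a c = (d - e)%N) (st : staircase K F (G %% F) c a).
Hypothesis nP : stair_function d m e c a n.

Let F0 : F != 0. Proof. by rewrite -size_poly_eq0 sF. Qed.

Let steps_le i : (i < c)%N -> (a i <= d - e)%N /\ (a i.+1 <= d - e)%N.
Proof.
by move=> ic; rewrite -ac; split; apply: (@increasing_le c a inc); lia.
Qed.

(** Replacing $G$ by its remainder modulo $F$ changes only the first coefficient, so the staircase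
    bounds $\deg v$ from below while $t$ bounds it from above. *)
Lemma graded_piece_low t w r :
  graded_piece t w -> size w = r.+1 -> (r + n r <= t)%N.
Proof.
case=> u [v [wE su sv]] sw; have [n1 n2 n3] := nP.
(* If $e>0$ then $\deg G=m>r$, so $vG$ must cancel against $uF$; the bound on [u] then sharpens the
   bound on [v] by $e$. *)
have eposP : (0 < e)%N -> v != 0 -> (r < m)%N -> (size v + m + e <= t.+1)%N.
  move=> e0 v0 rm.
  have G0 : G != 0 by rewrite -size_poly_eq0 sGe.
  have sv0 : (0 < size v)%N by rewrite size_poly_gt0.
  have svG : size (v * G) = (size v + m)%N by rewrite size_mulf // sGe; lia.
  have suF : size (u * F) = size (v * G).
    apply: size_combination_lt; rewrite addrC -wE sw svG; lia.
  have u0 : u != 0.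
    by apply/eqP=> u0; move: suF; rewrite u0 mul0r size_poly0 svG; lia.
  by move: suF; rewrite size_mulf // sF svG; lia.
have [rc|rc] := ltnP r (a c).
  have [i ic ir] := staircase_index _ _ _ a0 rc.
  rewrite (n1 i) //; have [ai aiS] := steps_le _ ic.
  have eq : w = (u + v * (G %/ F)) * F + v * (G %% F).
    by rewrite wE {1}(divp_eq G F); ring.
  have := (st _ _ ic ir).2 (u + v * (G %/ F)) v; rewrite -eq ac => /(_ sw) lv.
  have v0 : v != 0 by rewrite -size_poly_eq0; lia.
  move: lv sv; rewrite ac in rc; case: (posnP e) => [->|e0]; first by lia.
  by have := eposP e0 v0; lia.
have [rm|mr] := ltnP r m.
  rewrite n2; last by rewrite -ac rc.
  have [v0|v0] := eqVneq v 0.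
    have u0 : u != 0.
      by apply/eqP=> u0; move: sw; rewrite wE u0 v0 !mul0r addr0 size_poly0.
    by move: sw; rewrite wE v0 mul0r addr0 size_mulf // sF; lia.
  have sv0 : (0 < size v)%N by rewrite size_poly_gt0.
  by case: (posnP e) => [->|/eposP/(_ v0 rm)]; lia.
rewrite n3 // addn0 -ltnS -sw wE; apply: leq_trans (size_polyD _ _) _.
rewrite geq_max; apply/andP; split.
  have [->|u0] := eqVneq u 0; first by rewrite mul0r size_poly0.
  have su0 : (0 < size u)%N by rewrite size_poly_gt0.
  by rewrite size_mulf // sF; lia.
have [->|v0] := eqVneq v 0; first by rewrite mul0r size_poly0.
have sv0 : (0 < size v)%N by rewrite size_poly_gt0.
by apply: leq_trans (size_mulf_leq _ _ _) _; lia.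
Qed.

Let monic_multiple (H : {poly K}) s r : size H = s.+1 -> (s <= r)%N ->
  exists u, [/\ u * H \is monic, size (u * H) = r.+1 & size u = (r - s).+1].
Proof.
move=> sH sr; have H0 : H != 0 by rewrite -size_poly_eq0 sH.
have lH : lead_coef H != 0 by rewrite lead_coef_eq0.
exists ((lead_coef H)^-1 *: 'X^(r - s)); rewrite -scalerAl; split.
- by rewrite monicE lead_coefZ lead_coefM lead_coefXn mul1r mulVf.
- by rewrite size_scale ?invr_eq0 // size_monicM ?monicXn // size_polyXn sH; lia.
- by rewrite size_scale ?invr_eq0 // size_polyXn.
Qed.

Lemma graded_piece_monic r :
  exists Z, [/\ Z \is monic, size Z = r.+1 & graded_piece (r + n r) Z].
Proof.
have [n1 n2 n3] := nP.
have [rc|rc] := ltnP r (a c).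
  have [i ic ir] := staircase_index _ _ _ a0 rc.
  rewrite (n1 i) //; have [ai aiS] := steps_le _ ic.
  have [[U [V [mw sw sV]]] _] := st _ _ ic ir; rewrite ac in rc sV.
  exists (U * F + V * (G %% F)); split=> //.
  have eq : U * F + V * (G %% F) = (U - V * (G %/ F)) * F + V * G.
    by rewrite {3}(divp_eq G F); ring.
  exists (U - V * (G %/ F)), V; split=> //; last by lia.
  have [->|u0] := eqVneq (U - V * (G %/ F)) 0; first by rewrite size_poly0.
  have : (size ((U - V * (G %/ F)) * F)%R <= maxn r.+1 (size V + m))%N.
    have -> : (U - V * (G %/ F)) * F = (U * F + V * (G %% F)) - V * G by rewrite eq addrK.
    apply: leq_trans (size_subf_leq _ _ _) _; rewrite sw.
    by have := size_mulf_leq _ V G; lia.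
  by rewrite size_mulf // sF; lia.
have [rm|mr] := ltnP r m.
  rewrite ac in rc; rewrite n2 ?rc //.
  have [u [mu suF su]] := monic_multiple _ _ _ sF rc.
  exists (u * F); split=> //; exists u, 0; split; rewrite ?size_poly0 ?mul0r ?addr0 //; lia.
(* One generator keeps its full degree: $F$ when $e=0$, and $G$ otherwise. Its monic multiples serve
   all $r\ge m$. *)
rewrite n3 // addn0; case: (posnP e) => [e0|/sGe sG'].
  have dr : (d <= r)%N by lia.
  have [|u [mu suF su]] := monic_multiple F d r _ dr; first by rewrite sF; lia.
  exists (u * F); split=> //; exists u, 0; split; rewrite ?size_poly0 ?mul0r ?addr0 //; lia.
have [u [mu suG su]] := monic_multiple _ _ _ sG' mr.
exists (u * G); split=> //; exists 0, u; split; rewrite ?size_poly0 ?mul0r ?add0r //; lia.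
Qed.

End GradedPiece.

(** * Homogeneous ideals in two variables *)

Section Homogenization.
Variables (K : fieldType) (l z : {mpoly K[2]}) (h : 'I_2 -> {poly K}).
Implicit Types (p q : {mpoly K[2]}) (u v w : {poly K}).

(* h i is the variable X_i after setting l = 1 and z = X. *)
Definition dehomogenize : {mpoly K[2]} -> {poly K} := mmap (@polyC K) h.

HB.instance Definition _ := GRing.RMorphism.on dehomogenize.

(** Coefficients above degree [t] are dropped, so [dehomogenize] undoes this only for size at most
    [t.+1]. *)
Definition homogenize (t : nat) u : {mpoly K[2]} :=
  \sum_(i < t.+1) u`_i *: (z ^+ i * l ^+ (t - i)).

(** The last clause says that [l] and [z] span the linear forms compatibly with the substitution
    [h]; it makes every form of degree [t] a homogenization. *)
Definition linear_coordinates : Prop :=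
  [/\ l \is 1.-homog, z \is 1.-homog, dehomogenize l = 1, dehomogenize z = 'X &
      forall i, exists a b, h i = a%:P + b *: 'X /\ 'X_i = a *: l + b *: z].

Hypothesis lz : linear_coordinates.

Lemma dehomogenizeZ c p : dehomogenize (c *: p) = c *: dehomogenize p.
Proof. by rewrite /dehomogenize mmapZ mul_polyC. Qed.

Lemma homogenizeD t u v : homogenize t (u + v) = homogenize t u + homogenize t v.
Proof. by rewrite -big_split; apply: eq_bigr => i _; rewrite coefD scalerDl. Qed.

Lemma homogenizeZ t c u : homogenize t (c *: u) = c *: homogenize t u.
Proof. by rewrite scaler_sumr; apply: eq_bigr => i _; rewrite coefZ scalerA. Qed.

Lemma homogenize0 t : homogenize t 0 = 0.
Proof. by rewrite -(scale0r 0) homogenizeZ scale0r. Qed.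

Lemma homogenize_sum t (I : Type) (r : seq I) (Q : pred I) (E : I -> {poly K}) :
  homogenize t (\sum_(i <- r | Q i) E i) = \sum_(i <- r | Q i) homogenize t (E i).
Proof. exact: (big_morph _ (homogenizeD t) (homogenize0 t)). Qed.

Lemma homogenize_homog t u : homogenize t u \is t.-homog.
Proof.
have [ll zz _ _ _] := lz.
apply: rpred_sum => i _; apply: rpredZ.
have := dhomogM (dhomogMn i zz) (dhomogMn (t - i) ll).
by rewrite !mul1n subnKC // -ltnS.
Qed.

Lemma dehomogenizeK t u : (size u <= t.+1)%N -> dehomogenize (homogenize t u) = u.
Proof.
have [_ _ Dl Dz _] := lz.
move=> su; rewrite rmorph_sum /= -[RHS](coefK u) poly_def.
rewrite (big_ord_widen _ (fun i => u`_i *: 'X^i) su) [RHS]big_mkcond.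
apply: eq_bigr => i _; rewrite dehomogenizeZ rmorphM !rmorphXn /= Dl Dz expr1n mulr1.
by case: ltnP => // ui; rewrite nth_default // scale0r.
Qed.

Lemma homogenize_mull t u : (size u <= t.+1)%N ->
  l * homogenize t u = homogenize t.+1 u.
Proof.
move=> su; rewrite /homogenize [RHS]big_ord_recr /= [u`_t.+1]nth_default // scale0r addr0.
rewrite mulr_sumr; apply: eq_bigr => i _; rewrite -scalerAr; congr (_ *: _).
by rewrite mulrCA -exprS subSn // -ltnS.
Qed.

Lemma homogenize_mulz t u : z * homogenize t u = homogenize t.+1 ('X * u).
Proof.
rewrite /homogenize [RHS]big_ord_recl /= coefXM /= scale0r add0r.
rewrite mulr_sumr; apply: eq_bigr => i _; rewrite -scalerAr; congr (_ *: _).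
  by rewrite coefXM.
by rewrite mulrA -exprS subSS.
Qed.

Let homogenized t p := exists2 u : {poly K}, (size u <= t.+1)%N & p = homogenize t u.

(** Induction on the degree: one variable is split off and written as a combination of [l] and [z],
    both of which act on homogenizations. *)
Let homogenized_monomial (m : 'X_{1..2}) : homogenized (mdeg m) 'X_[m].
Proof.
have [_ _ _ _ X_] := lz.
move: {2}(mdeg m) (erefl (mdeg m)) => t; elim: t m => [|t IH] m mt.
  move/eqP: (mt); rewrite mdeg_eq0 => /eqP ->; exists 1; rewrite ?size_poly1 //.
  by rewrite mdeg0 /homogenize big_ord1 /= coef1 /= !expr0 mul1r scale1r mpolyX0.
have [i mi] : exists i : 'I_2, (0 < m i)%N.
  apply/existsP; apply: contraT; rewrite negb_exists => /forallP m0.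
  by move: mt; rewrite mdegE big1 // => i _; apply/eqP; rewrite -leqn0 leqNgt m0.
have mE : m = (U_(i) + (m - U_(i)))%MM.
  by rewrite addmC submK //; apply/mnm_lepP => j; rewrite mnmE; case: eqP => // <-.
have mt' : mdeg (m - U_(i)) = t by move: mt; rewrite {1}mE mdegD mdeg1 => -[].
have [u su uE] := IH _ mt'; rewrite mt; rewrite mt' in su uE.
have [b [c [_ XE]]] := X_ i.
exists (b *: u + c *: ('X * u)).
  apply: leq_trans (size_polyD _ _) _; rewrite geq_max.
  apply/andP; split; apply: leq_trans (size_scale_leq _ _) _; first exact: leq_trans su _.
  by apply: leq_trans (size_polyMleq _ _) _; rewrite size_polyX.
rewrite {1}mE mpolyXD XE uE homogenizeD !homogenizeZ mulrDl -!scalerAl.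
by rewrite homogenize_mull // homogenize_mulz.
Qed.

Let homogenizedP t p : p \is t.-homog -> homogenized t p.
Proof.
move=> hp; rewrite (mpolyE p) big_seq.
apply: (@big_ind _ (homogenized t)).
- by exists 0; rewrite ?size_poly0 ?homogenize0.
- move=> _ _ [u su ->] [v sv ->]; exists (u + v); last by rewrite homogenizeD.
  by apply: leq_trans (size_polyD _ _) _; rewrite geq_max su.
move=> m pm; have [u su ->] := homogenized_monomial m.
have mt : mdeg m = t := dhomog_mf hp pm.
rewrite mt in su *; exists (p@_m *: u); last by rewrite homogenizeZ.
exact: leq_trans (size_scale_leq _ _) su.
Qed.

Lemma size_dehomogenize t p : p \is t.-homog -> (size (dehomogenize p) <= t.+1)%N.
Proof. by case/homogenizedP=> u su ->; rewrite dehomogenizeK. Qed.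

Lemma homogenizeK t p : p \is t.-homog -> homogenize t (dehomogenize p) = p.
Proof. by case/homogenizedP=> u su ->; rewrite dehomogenizeK. Qed.

Lemma homogenizeM s t u v : (size u <= s.+1)%N -> (size v <= t.+1)%N ->
  homogenize (s + t) (u * v) = homogenize s u * homogenize t v.
Proof.
move=> su sv; rewrite -[RHS](@homogenizeK (s + t)) ?rmorphM /= ?dehomogenizeK //.
by rewrite dhomogM // homogenize_homog.
Qed.

Lemma homogenize1 t : homogenize t 1 = l ^+ t.
Proof.
have [ll _ Dl _ _] := lz; have := dhomogMn t ll; rewrite mul1n => /homogenizeK.
by rewrite rmorphXn /= Dl expr1n.
Qed.

Lemma homogenizeX t : homogenize t 'X^t = z ^+ t.
Proof.
have [_ zz _ Dz _] := lz; have := dhomogMn t zz; rewrite mul1n => /homogenizeK.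
by rewrite rmorphXn /= Dz.
Qed.

Lemma homogenize_shift a t u : (size u <= t.+1)%N ->
  homogenize (a + t) u = l ^+ a * homogenize t u.
Proof. by move=> su; rewrite -homogenize1 -homogenizeM ?mul1r // size_poly1. Qed.

End Homogenization.

Lemma linear_coordinatesP (K : fieldType) (l : {mpoly K[2]}) :
  l \is 1.-homog -> l != 0 -> exists z h, linear_coordinates K l z h.
Proof.
move=> ll l0; pose a i := l@_U_(i).
have X1 (i : 'I_2) : 'X_i \is @ishomog1 2 K 1 mdeg by rewrite dhomogX; apply/eqP; exact: mdeg1.
pose o0 : 'I_2 := ord0; pose o1 : 'I_2 := ord_max.
have ord2 (i : 'I_2) : i = o0 \/ i = o1.
  by case: i => -[|[|//]] ip; [left | right]; apply: val_inj.
have lE : l = a o0 *: 'X_o0 + a o1 *: 'X_o1.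
  apply/mpolyP => m; rewrite mcoeffD !mcoeffZ !mcoeffX.
  have [m1|m1] := eqVneq (mdeg m) 1%N; last first.
    rewrite (dhomog_nemf_coeff ll m1).
    have n1 (i : 'I_2) : (U_(i)%MM == m) = false.
      by apply: contraNF m1 => /eqP <-; rewrite mdeg1.
    by rewrite !n1 !mulr0 addr0.
  have /mdeg1P[i /eqP ->] : mdeg m == 1%N by rewrite m1.
  rewrite !eq_mnm1; case: (ord2 i) => ->; rewrite ?eqxx /= ?mulr1 ?mulr0 ?addr0 ?add0r //.
have DX h (i : 'I_2) : dehomogenize K h 'X_i = h i by rewrite /dehomogenize mmapX mmap1U.
have Dl h : dehomogenize K h l = a o0 *: h o0 + a o1 *: h o1.
  by rewrite lE rmorphD /= !dehomogenizeZ !DX.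
have o10 : (o1 == o0) = false by [].
(* The second coordinate is a variable independent of [l]: ['X_o0] if its coefficient in [l]
   vanishes, ['X_o1] otherwise. *)
have [a0|a0] := eqVneq (a o0) 0.
  have a1 : a o1 != 0.
    by apply: contraNneq l0 => a1; rewrite lE a0 a1 !scale0r addr0.
  exists 'X_o0, (fun i => if i == o0 then 'X else ((a o1)^-1)%:P); split=> //.
  - by rewrite Dl a0 scale0r add0r o10 -mul_polyC -polyCM mulfV.
  - by rewrite DX.
  - move=> i; case: (ord2 i) => ->.
      by exists 0, 1; rewrite eqxx polyC0 !add0r !scale1r scale0r add0r.
    exists (a o1)^-1, 0; rewrite o10 !scale0r !addr0; split=> //.
    by rewrite lE a0 scale0r add0r scalerA mulVf // scale1r.
exists 'X_o1, (fun i => if i == o0 then ((a o0)^-1)%:P + (- ((a o0)^-1 * a o1)) *: 'X else 'X).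
split=> //.
- rewrite Dl eqxx o10 scalerDr scalerA mulrN mulrA mulfV // mul1r scaleNr addrNK.
  by rewrite -mul_polyC -polyCM mulfV.
- by rewrite DX.
- move=> i; case: (ord2 i) => ->.
    exists (a o0)^-1, (- ((a o0)^-1 * a o1)); rewrite eqxx; split=> //.
    by rewrite {1}lE scalerDr !scalerA mulVf // scale1r scaleNr addrK.
  by exists 0, 1; rewrite o10 polyC0 !add0r !scale1r scale0r add0r.
Qed.

Lemma pihomogMl (n : nat) (R : comNzRingType) (d t : nat) (p q : {mpoly R[n]}) :
  q \is d.-homog ->
  pihomog mdeg t (p * q) = if (d <= t)%N then pihomog mdeg (t - d) p * q else 0.
Proof.
(* The range reaches beyond [t] so that it contains $t-d$, the index of the only contributing
   component. *)
move=> hq; pose k := maxn (mmeasure mdeg p) t.+1.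
have pE : p = \sum_(i < k) pihomog mdeg i p.
  by apply: pihomog_partitionE; apply: leq_maxl.
rewrite {1}pE mulr_suml linear_sum /=.
have term (i : 'I_k) : pihomog mdeg t (pihomog mdeg i p * q) =
    if (i + d == t)%N then pihomog mdeg i p * q else 0.
  have hi : pihomog mdeg i p * q \is (i + d).-homog by rewrite dhomogM ?pihomogP.
  case: eqP => [<-|/eqP ne]; first exact: pihomog_dE hi.
  exact: pihomog_ne0 ne hi.
rewrite (eq_bigr _ (fun i _ => term i)) -big_mkcond /=.
case: leqP => [dt|td]; last by apply: big_pred0 => i; apply/eqP; lia.
have tk : (t - d < k)%N by apply: leq_trans (leq_maxr _ _); rewrite ltnS leq_subr.
rewrite (big_pred1 (Ordinal tk)) // => i.
by rewrite /= -val_eqE /=; apply/eqP/eqP; lia.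
Qed.

Definition in_ideal2 {R : comNzRingType} (f g p : R) : Prop :=
  exists a b, p = a * f + b * g.

Section Ideal2.
Variables (R : comNzRingType) (f g : R).

Lemma in_ideal2_0 : in_ideal2 f g 0.
Proof. by exists 0, 0; rewrite !mul0r addr0. Qed.

Lemma in_ideal2D p q : in_ideal2 f g p -> in_ideal2 f g q -> in_ideal2 f g (p + q).
Proof. by move=> [a [b ->]] [a' [b' ->]]; exists (a + a'), (b + b'); ring. Qed.

Lemma in_ideal2M p q : in_ideal2 f g q -> in_ideal2 f g (p * q).
Proof. by move=> [a [b ->]]; exists (p * a), (p * b); ring. Qed.

Lemma in_ideal2C p : in_ideal2 g f p -> in_ideal2 f g p.
Proof. by move=> [a [b ->]]; exists b, a; rewrite addrC. Qed.

End Ideal2.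

Section HomogeneousIdeal.
Variables (K : fieldType) (l z : {mpoly K[2]}) (h : 'I_2 -> {poly K}).
Hypothesis lz : linear_coordinates K l z h.
Variables (f g : {mpoly K[2]}) (d m : nat).
Hypotheses (hf : f \is d.-homog) (hg : g \is m.-homog).
Local Notation D := (dehomogenize K h).
Local Notation H := (homogenize K l z).
Local Notation I := (in_ideal2 f g).
Local Notation piece := (graded_piece K (D f) (D g) d m).
Implicit Types (p q : {mpoly K[2]}).

Lemma in_ideal2Z c p : I p -> I (c *: p).
Proof. by rewrite -mul_mpolyC; apply: in_ideal2M. Qed.

Lemma in_ideal2_pihomog t p : I p -> I (pihomog mdeg t p).
Proof.
move=> [a [b ->]]; rewrite linearD /= (pihomogMl _ _ _ _ _ _ hf) (pihomogMl _ _ _ _ _ _ hg).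
apply: in_ideal2D; case: ifP => _; try exact: in_ideal2_0; apply: in_ideal2M.
  by exists 1, 0; ring.
by exists 0, 1; ring.
Qed.

(** The cofactors need not be homogeneous; their components of degrees $t-d$ and $t-m$ already
    produce the part of degree $t$. *)
Lemma dehomogenize_piece t p : I p -> piece t (D (pihomog mdeg t p)).
Proof.
have part (q a : {mpoly K[2]}) e : q \is e.-homog ->
    exists2 u, D (pihomog mdeg t (a * q)) = u * D q & (size u <= t.+1 - e)%N.
  move=> hq; rewrite (pihomogMl _ _ _ _ _ _ hq); case: leqP => [et|te].
    exists (D (pihomog mdeg (t - e) a)); first by rewrite rmorphM.
    by rewrite subSn // (size_dehomogenize _ _ _ _ lz) ?pihomogP.
  by exists 0; rewrite ?size_poly0 // rmorph0 mul0r.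
move=> [a [b ->]]; rewrite linearD rmorphD /=.
have [u -> su] := part f a d hf; have [v -> sv] := part g b m hg.
by exists u, v.
Qed.

Lemma homogenize_piece t (w : {poly K}) : piece t w -> I (H t w).
Proof.
have part (q : {mpoly K[2]}) (u : {poly K}) e : q \is e.-homog -> (size u <= t.+1 - e)%N ->
    exists p, H t (u * D q) = p * q.
  move=> hq su; have [et|te] := leqP e t.
    exists (H (t - e) u); rewrite -{1}(subnK et) (homogenizeM _ _ _ _ lz).
    - by rewrite (homogenizeK _ _ _ _ lz).
    - by rewrite -subSn.
    - exact: (size_dehomogenize _ _ _ _ lz).
  exists 0; have /eqP-> : u == 0 by rewrite -size_poly_eq0; lia.
  by rewrite !mul0r homogenize0.
move=> [u [v [-> su sv]]]; rewrite homogenizeD.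
have [p ->] := part f u d hf su; have [q ->] := part g v m hg sv.
by exists p, q.
Qed.

Lemma piece_homogenize t (w : {poly K}) : (size w <= t.+1)%N -> I (H t w) -> piece t w.
Proof.
move=> sw /(dehomogenize_piece t).
by rewrite pihomog_dE ?(dehomogenizeK _ _ _ _ lz) // (homogenize_homog _ _ _ _ lz).
Qed.

(** * The Jordan strings as a basis of the quotient *)

Section Basis.
Variables (n : seq nat) (Z : nat -> {poly K}).
Hypothesis (Zmonic : forall r, Z r \is monic) (Zsize : forall r, size (Z r) = r.+1).
Hypothesis Zpiece : forall r, piece (r + nth 0%N n r) (Z r).
Hypothesis low : forall t (w : {poly K}) r, piece t w -> size w = r.+1 -> (r + nth 0%N n r <= t)%N.
Local Notation box := 'I_(\sum_(r < size n) nth 0%N n r)%N.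
Local Notation row := (fun i : box => nat_of_ord (tagnat.sig1 i)).
Local Notation col := (fun i : box => nat_of_ord (tagnat.sig2 i)).

Lemma box_eq (i j : box) : row i = row j -> col i = col j -> i = j.
Proof.
move=> rij cij; apply: val_inj; apply/eqP.
rewrite -(tagnat.sig2K i) -(tagnat.sig2K j) /= tagnat.eq_Rank cij eqxx andbT.
by apply/eqP; apply: val_inj.
Qed.

Lemma box_exists r a : (a < nth 0%N n r)%N -> exists i : box, row i = r /\ col i = a.
Proof.
move=> ar; have rn : (r < size n)%N.
  by rewrite ltnNge; apply/negP => nr; move: ar; rewrite nth_default.
exists (tagnat.Rank (p_ := fun r : 'I_(size n) => nth 0%N n r) (Ordinal rn) (Ordinal ar)).
by split; [rewrite tagnat.Rank1K | rewrite tagnat.Rank2K].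
Qed.

Definition box_form (i : box) : {mpoly K[2]} := l ^+ col i * H (row i) (Z (row i)).

Lemma box_formE i : box_form i = H (row i + col i) (Z (row i)).
Proof. by rewrite addnC (homogenize_shift _ _ _ _ lz) // Zsize. Qed.

Lemma box_col_lt (i : box) : (col i < nth 0%N n (row i))%N.
Proof. exact: ltn_ord (tagnat.sig2 i). Qed.

Lemma box_form_next i j : row j = row i -> col j = (col i).+1 ->
  l * box_form i = box_form j.
Proof. by move=> rji cji; rewrite /box_form cji mulrA -exprS; congr (_ * _); rewrite rji. Qed.

Lemma box_form_last i : (col i).+1 = nth 0%N n (row i) -> I (l * box_form i).
Proof.
move=> last; rewrite /box_form mulrA -exprS last.
rewrite -(homogenize_shift _ _ _ _ lz) ?Zsize // addnC.
exact: homogenize_piece.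
Qed.

(** Leading coefficients are eliminated from the top, as there is one monic [Z r] in each degree. *)
Let expansion t (w : {poly K}) : (size w <= t.+1)%N ->
  exists c : nat -> K, w = \sum_(r < t.+1) c r *: Z r.
Proof.
elim: t w => [|t IH] w sw.
  exists (fun=> w`_0); rewrite big_ord1 /= (size1_polyC sw).
  have -> : Z 0%N = 1.
    by have := Zmonic 0; rewrite (size1_polyC (eq_leq (Zsize 0))) monicE lead_coefC => /eqP ->.
  by rewrite coefC eqxx alg_polyC.
have := IH (w - w`_t.+1 *: Z t.+1) _; case.
  apply/leq_sizeP => j tj; rewrite coefB coefZ.
  move: tj; rewrite leq_eqVlt => /orP[/eqP<-|tj].
    have /monicP := Zmonic t.+1; rewrite lead_coefE Zsize /= => ->.
    by rewrite mulr1 subrr.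
  rewrite [w`_j]nth_default ?(leq_trans sw) // [_`_j]nth_default ?Zsize //.
  by rewrite mulr0 subr0.
move=> c wE; exists (fun r => if r == t.+1 then w`_t.+1 else c r).
rewrite big_ord_recr /= eqxx -[LHS](subrK (w`_t.+1 *: Z t.+1)) wE; congr (_ + _).
by apply: eq_bigr => i _; rewrite ltn_eqF.
Qed.

Let spanned p := exists c : box -> K, I (p - \sum_i c i *: box_form i).

Let spannedD p q : spanned p -> spanned q -> spanned (p + q).
Proof.
move=> [c hc] [c' hc']; exists (fun i => c i + c' i).
have -> : p + q - \sum_i (c i + c' i) *: box_form i =
    (p - \sum_i c i *: box_form i) + (q - \sum_i c' i *: box_form i).
  by under eq_bigr do rewrite scalerDl; rewrite big_split /= opprD addrACA.
exact: in_ideal2D.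
Qed.

Let spannedZ c p : spanned p -> spanned (c *: p).
Proof.
move=> [b hb]; exists (fun i => c * b i).
under eq_bigr do rewrite -scalerA; rewrite -scaler_sumr -scalerBr.
exact: in_ideal2Z.
Qed.

Let spanned_sum (J : finType) (E : J -> {mpoly K[2]}) :
  (forall j, spanned (E j)) -> spanned (\sum_j E j).
Proof.
move=> sE; apply: big_ind => [||j _]; [|exact: spannedD|exact: sE].
exists (fun=> 0); rewrite big1 ?subr0; last by move=> i _; rewrite scale0r.
exact: in_ideal2_0.
Qed.

Lemma box_form_span p : exists c : box -> K, I (p - \sum_i c i *: box_form i).
Proof.
rewrite -/(spanned p) (pihomog_partitionE (leqnn (mmeasure mdeg p))).
apply: spanned_sum => t; have ht := pihomogP mdeg t p.
rewrite -(homogenizeK _ _ _ _ lz _ _ ht).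
have [c ->] := expansion t _ (size_dehomogenize _ _ _ _ lz _ _ ht).
rewrite homogenize_sum; apply: spanned_sum => r; rewrite homogenizeZ; apply: spannedZ.
have rt : (r <= t)%N by rewrite -ltnS.
(* $l^{t-r}z_r$ is itself a string element if $t-r<n_r$; otherwise it is a multiple of $l^{n_r}z_r$,
   which lies in the ideal. *)
have [lt|le] := ltnP (t - r) (nth 0%N n r).
  have [i [ri ci]] := box_exists _ _ lt; exists (fun j => (j == i)%:R).
  rewrite (bigD1 i) //= eqxx scale1r big1 ?addr0; last first.
    by move=> j /negbTE->; rewrite scale0r.
  by rewrite box_formE ci ri subnKC // subrr; apply: in_ideal2_0.
exists (fun=> 0); rewrite big1 ?subr0; last by move=> i _; rewrite scale0r.
have -> : H t (Z r) = H (t - r - nth 0%N n r + (r + nth 0%N n r)) (Z r).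
  by congr (H _ _); lia.
rewrite (homogenize_shift _ _ _ _ lz); last by rewrite Zsize ltnS leq_addr.
by apply: in_ideal2M; apply: homogenize_piece.
Qed.

(** The ideal is homogeneous, so a relation can be restricted to one degree $t$. After setting $l=1$
    its degree is the largest row involved, and [low] then contradicts that the box lies within its
    row. *)
Lemma box_form_free (c : box -> K) :
  I (\sum_i c i *: box_form i) -> forall i, c i = 0.
Proof.
move=> Ic i0; apply/eqP; apply: contraT => ci0.
pose t := (row i0 + col i0)%N.
pose w := \sum_(i | (row i + col i == t)%N) c i *: Z (row i).
have wt : piece t w.
  apply: piece_homogenize.
    apply: (leq_trans (size_sum _ _ _)); apply/bigmax_leqP => i /eqP it.
    by apply: leq_trans (size_scale_leq _ _) _; rewrite Zsize ltnS -it leq_addr.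
  have := in_ideal2_pihomog t _ Ic; congr (I _).
  rewrite linear_sum homogenize_sum [RHS]big_mkcond /=; apply: eq_bigr => i _.
  rewrite linearZ homogenizeZ /= box_formE.
  have hi := homogenize_homog K l z h lz (row i + col i) (Z (row i)).
  case: eqP => [<-|/eqP ne]; first by rewrite pihomog_dE.
  by rewrite (pihomog_ne0 ne hi) scaler0.
pose Q i := (row i + col i == t)%N && (c i != 0).
have Qi0 : Q i0 by rewrite /Q eqxx.
case: (arg_maxnP (fun i => row i) Qi0) => i1 /andP[/eqP i1t ci1] max1.
(* A diagonal meets each row at most once, so the leading term from the largest row survives. *)
have sw : size w = (row i1).+1.
  rewrite /w (bigD1 i1) ?i1t ?eqxx //= size_polyDl size_scale // Zsize // ltnS.
  apply: (leq_trans (size_sum _ _ _)); apply/bigmax_leqP => i /andP[/eqP it ne].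
  have [->|ci] := eqVneq (c i) 0; first by rewrite scale0r size_poly0.
  rewrite size_scale // Zsize.
  have := max1 i; rewrite /Q it eqxx ci => /(_ isT) /=.
  rewrite leq_eqVlt => /orP[/eqP e|//]; case/eqP: ne.
  by apply: box_eq => //=; apply: (@addnI (row i)); rewrite it {1}e i1t.
by have := low _ _ _ wt sw; have := box_col_lt i1; rewrite -i1t /=; lia.
Qed.

End Basis.
End HomogeneousIdeal.

(** * Jordan blocks *)

Section JordanBlocks.
Variables (K : fieldType) (V : vectType K) (f : 'End(V)).

Section Boxes.
Variable P : seq nat.
Local Notation box := 'I_(\sum_(r < size P) nth 0%N P r)%N.
Local Notation row := (fun i : box => nat_of_ord (tagnat.sig1 i)).
Local Notation col := (fun i : box => nat_of_ord (tagnat.sig2 i)).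

Lemma jordan_mxE (i j : box) :
  jordan_mx K P i j = ((row i == row j) && ((col i).+1 == col j))%:R.
Proof.
rewrite /jordan_mx /mxdiag /mxblock mxE.
case: (tagnat.sig2 i) (tagnat.sig2 j) => a ap [b bp] /=.
rewrite val_eqE; move: ap bp; case: eqP => [<-|_] ap bp /=.
  by rewrite conform_mx_id mxE.
by rewrite mxE.
Qed.

Lemma jordan_mx_sum (e : box -> V) i :
  (forall j, row j = row i -> col j = (col i).+1 ->
     \sum_j jordan_mx K P i j *: e j = e j) /\
  ((col i).+1 = nth 0%N P (row i) -> \sum_j jordan_mx K P i j *: e j = 0).
Proof.
split=> [j rj cj|last].
  rewrite (bigD1 j) //= jordan_mxE cj rj !eqxx scale1r big1 ?addr0 // => k kj.
  rewrite jordan_mxE; case: eqP => [rk|_]; last by rewrite scale0r.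
  case: eqP => [ck|_]; last by rewrite andbF scale0r.
  by case/eqP: kj; apply: box_eq; [rewrite /= rj rk | rewrite /= cj ck].
rewrite big1 // => k _; rewrite jordan_mxE; case: eqP => [rk|_]; last by rewrite scale0r.
case: eqP => [ck|_]; last by rewrite andbF scale0r.
by have := box_col_lt _ k; rewrite /= -ck -rk last ltnn.
Qed.

Lemma has_jordan_blocks_family (e : box -> V) :
  (forall c : box -> K, \sum_i c i *: e i = 0 -> forall i, c i = 0) ->
  (forall v, exists c : box -> K, v = \sum_i c i *: e i) ->
  (forall i j, row j = row i -> col j = (col i).+1 -> f (e i) = e j) ->
  (forall i, (col i).+1 = nth 0%N P (row i) -> f (e i) = 0) ->
  has_jordan_blocks f P.
Proof.
move=> e_free e_span next last; exists [tuple e i | i < _]; split.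
  apply/andP; split; last first.
    apply/freeP => c c0; apply: e_free; rewrite -[RHS]c0.
    by apply: eq_bigr => i _; rewrite -tnth_nth tnth_mktuple.
  rewrite eqEsubv subvf; apply/subvP => v _; have [c ->] := e_span v.
  apply: memv_suml => i _; apply: memvZ; apply: memv_span.
  by apply/tnthP; exists i; rewrite tnth_mktuple.
move=> i; rewrite tnth_mktuple; under eq_bigr do rewrite tnth_mktuple.
have [step stop] := jordan_mx_sum e i.
have := box_col_lt _ i; rewrite leq_eqVlt => /orP[/eqP eq|lt].
  by rewrite last // stop.
have [j [rj cj]] := box_exists _ _ _ lt.
by rewrite (next i j) // (step j).
Qed.

Lemma count_boxes a :
  #|[pred i : box | a <= col i]%N| = (\sum_(r < size P) (nth 0 P r - a))%N.
Proof.
have -> : (\sum_(r < size P) (nth 0 P r - a) =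
    \sum_(r < size P) \sum_(j < nth 0 P r) (a <= j))%N.
  apply: eq_bigr => r _; elim: (nth 0%N P r) => [|p IH]; first by rewrite big_ord0.
  by rewrite big_ord_recr /= -IH; case: leqP; lia.
rewrite sig_big_dep (reindex _ (@tagnat.sig_bij_on _ _)) /= -sum1_card big_mkcond /=.
by apply: eq_bigr => i _; rewrite inE /tagnat.sig2; case: (a <= _)%N.
Qed.

(** The map shifts each basis vector one column to the right or kills it, so the image of the power
    [a] is spanned by the vectors in columns at least [a]. *)
Lemma dim_iter_limg a : has_jordan_blocks f P ->
  \dim (iter a (fun W => (f @: W)%VS) fullv) = (\sum_(r < size P) (nth 0 P r - a))%N.
Proof.
case=> e [/andP[/eqP span_e free_e] fe]; rewrite -count_boxes.
have {}fe i : f (tnth e i) = \sum_j jordan_mx K P i j *: tnth e j by [].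
have -> : iter a (fun W => (f @: W)%VS) fullv =
    <<[seq tnth e i | i <- enum 'I_(\sum_(r < size P) nth 0%N P r) & (a <= col i)%N]>>%VS.
  elim: a => [|a IH].
    by rewrite filter_predT map_tnth_enum span_e.
  rewrite iterS IH limg_span; apply/eqP; rewrite eqEsubv; apply/andP.
  split; apply/span_subvP => v.
    case/mapP=> _ /mapP[i + ->] ->; rewrite mem_filter fe => /andP[ai _].
    have [step stop] := jordan_mx_sum (tnth e) i.
    have := box_col_lt _ i; rewrite leq_eqVlt => /orP[/eqP eq|lt].
      by rewrite stop // mem0v.
    have [j [rj cj]] := box_exists _ _ _ lt.
    rewrite (step j) //; apply/memv_span/mapP; exists j => //.
    by rewrite mem_filter mem_enum /= cj ltnS ai.
  case/mapP=> j; rewrite mem_filter => /andP[aj _] ->; apply: memv_span.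
  have lt : ((col j).-1 < nth 0 P (row j))%N by apply: leq_ltn_trans (leq_pred _) (box_col_lt _ j).
  have [i [ri ci]] := box_exists _ _ _ lt.
  have [step _] := jordan_mx_sum (tnth e) i.
  have cj : col j = (col i).+1 by rewrite /= ci prednK //; apply: leq_trans aj.
  rewrite -(step j) // -fe; apply: map_f; apply: map_f.
  by rewrite mem_filter mem_enum andbT -ltnS -cj.
have /eqP -> : free [seq tnth e i | i <- enum 'I_(\sum_(r < size P) nth 0%N P r) & (a <= col i)%N].
  move: free_e; rewrite -{1}[e in free e]map_tnth_enum.
  rewrite -(perm_free (perm_map _ (permEl (perm_filterC (fun i => a <= col i)%N _)))) map_cat.
  exact: catl_free.
rewrite size_map size_filter -sum1_count big_enum_cond -sum1_card.
by apply: eq_bigl => i; rewrite !inE.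
Qed.

End Boxes.
End JordanBlocks.

(** The rank drop from the power [c] to [c.+1] is the length of column [c]; hence the map determines
    the columns and thereby the rows. *)
Lemma jordan_blocks_unique (K : fieldType) (V : vectType K) (f : 'End(V)) (P Q : seq nat) :
  nonincreasing P -> nonincreasing Q ->
  has_jordan_blocks f P -> has_jordan_blocks f Q -> forall r, nth 0 P r = nth 0 Q r.
Proof.
move=> niP niQ fP fQ r.
have column_diff S c : (column_length S c +
    \sum_(r < size S) (nth 0 S r - c.+1) = \sum_(r < size S) (nth 0 S r - c))%N.
  rewrite /column_length -(big_mkord xpredT (fun r => nth 0 S r - c)%N).
  rewrite -(big_mkord xpredT (fun r => nth 0 S r - c.+1)%N).
  rewrite -!(big_nth 0%N xpredT (fun p => p - _)%N).
  elim: S => [|p S IH]; first by rewrite !big_nil.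
  rewrite /= !big_cons -IH; case: (ltnP c p); lia.
have columns c : column_length P c = column_length Q c.
  have := column_diff P c; have := column_diff Q c.
  rewrite -!(dim_iter_limg K V f) //; lia.
apply/eqP; rewrite eqn_leq; apply/andP; split; rewrite leqNgt; apply/negP.
  by rewrite lt_nth_column // columns -lt_nth_column // ltnn.
by rewrite lt_nth_column // -columns -lt_nth_column // ltnn.
Qed.

Lemma graded_jordan_blocks (K : fieldType) (l z : {mpoly K[2]}) (h : 'I_2 -> {poly K})
    (f g : {mpoly K[2]}) (d m : nat) (n : seq nat) (Z : nat -> {poly K})
    (A : falgType K) (phi : {lrmorphism {mpoly K[2]} -> A}) :
  linear_coordinates K l z h -> f \is d.-homog -> g \is m.-homog ->
  let piece := graded_piece K (dehomogenize K h f) (dehomogenize K h g) d m in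
  (forall r, [/\ Z r \is monic, size (Z r) = r.+1 & piece (r + nth 0%N n r)%N (Z r)]) ->
  (forall t w r, piece t w -> size w = r.+1 -> (r + nth 0%N n r <= t)%N) ->
  (forall u, exists p, phi p = u) ->
  (forall p, phi p = 0 <-> in_ideal2 f g p) ->
  has_jordan_blocks (amull (phi l)) n.
Proof.
move=> lz hf hg piece hZ low phi_surj phi_ker.
have Zm r : Z r \is monic by case: (hZ r).
have Zs r : size (Z r) = r.+1 by case: (hZ r).
have Zp r : piece (r + nth 0%N n r)%N (Z r) by case: (hZ r).
have phi_sum (c : 'I_(\sum_(r < size n) nth 0%N n r)%N -> K) :
    \sum_i c i *: phi (box_form K l z n Z i) = phi (\sum_i c i *: box_form K l z n Z i).
  by rewrite linear_sum; apply: eq_bigr => i _; rewrite linearZ.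
apply: (has_jordan_blocks_family K A _ n (fun i => phi (box_form K l z n Z i))).
- move=> c; rewrite phi_sum => /phi_ker.
  exact: (box_form_free K l z h lz f g d m hf hg n Z Zs low).
- move=> v; have [p <-] := phi_surj v.
  have [c] := box_form_span K l z h lz f g d m hf hg n Z Zm Zs Zp p.
  move=> /phi_ker; rewrite linearB /= => /eqP; rewrite subr_eq0 => /eqP->.
  by exists c; rewrite phi_sum.
- move=> i j rj cj; rewrite lfunE /= -rmorphM.
  by rewrite (box_form_next K l z n Z i j).
- move=> i last; rewrite lfunE /= -rmorphM; apply/phi_ker.
  exact: (box_form_last K l z h lz f g d m hf hg n Z Zs Zp).
Qed.

(** * Finite-dimensional quotient algebras *)

Section QuotientAlgebra.
Variables (K : fieldType) (R : comAlgType K) (N : nat).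

Record coordinate_quotient := CoordinateQuotient {
  quotient_coord : {linear R -> 'rV[K]_N};
  quotient_lift : 'rV[K]_N -> R;
  quotient_liftK : cancel quotient_lift quotient_coord;
  quotient_ideal : forall p q, quotient_coord q = 0 -> quotient_coord (p * q) = 0;
  quotient_proper : quotient_coord 1 != 0 }.

(** [Q] is a phantom argument, the key by which an algebra structure is attached to a copy of the
    row vectors. *)
Definition quotient_space (Q : coordinate_quotient) : Type := 'rV[K]_N.

Variable Q : coordinate_quotient.
Local Notation A := (quotient_space Q).
Local Notation coord := (quotient_coord Q).
Local Notation lift := (quotient_lift Q).

HB.instance Definition _ := Vector.copy A 'rV[K]_N.

Let mul (v w : A) : A := coord (lift v * lift w).

Let mul_coord p q : mul (coord p) (coord q) = coord (p * q).
Proof.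
apply/eqP; rewrite -subr_eq0 -linearB; apply/eqP.
(* Each correction [lift (coord p) - p] has coordinate 0, and the elements of coordinate 0 form an
   ideal. *)
have -> : lift (coord p) * lift (coord q) - p * q =
   lift (coord p) * (lift (coord q) - q) + q * (lift (coord p) - p) by ring.
by rewrite linearD !quotient_ideal ?addr0 // linearB quotient_liftK subrr.
Qed.

Let coordP (v : A) : exists p, v = coord p.
Proof. by exists (lift v); rewrite quotient_liftK. Qed.

Let mulA : associative mul.
Proof.
move=> u v w; have [p ->] := coordP u; have [q ->] := coordP v; have [r ->] := coordP w.
by rewrite !mul_coord mulrA.
Qed.

Let mulC : commutative mul.
Proof. by move=> u v; rewrite /mul mulrC. Qed.

Let mul1 : left_id (coord 1 : A) mul.
Proof. by move=> u; have [p ->] := coordP u; rewrite mul_coord mul1r. Qed.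

Let mulDl : left_distributive mul +%R.
Proof.
move=> u v w; have [p ->] := coordP u; have [q ->] := coordP v; have [r ->] := coordP w.
by rewrite -linearD !mul_coord mulrDl linearD.
Qed.

HB.instance Definition _ := GRing.Zmodule_isComNzRing.Build A
  mulA mulC mul1 mulDl (quotient_proper Q).

Let scaleAl (k : K) (u v : A) : k *: (u * v) = k *: u * v.
Proof.
have [p ->] := coordP u; have [q ->] := coordP v.
change (k *: mul (coord p) (coord q) = mul (k *: (coord p : 'rV_N)) (coord q)).
by rewrite mul_coord -!linearZ mul_coord scalerAl.
Qed.

HB.instance Definition _ := GRing.Lmodule_isLalgebra.Build K A scaleAl.
HB.instance Definition _ := GRing.Lalgebra_isComAlgebra.Build K A.
HB.instance Definition _ := Algebra_isFalgebra.Build K A.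

Definition quotient_map (p : R) : A := coord p.

Let quotient_map_linear : linear quotient_map.
Proof. exact: linearP. Qed.

Let quotient_map_monoid : monoid_morphism quotient_map.
Proof. by split=> // p q; rewrite -mul_coord. Qed.

HB.instance Definition _ := GRing.isLinear.Build K R A _ quotient_map quotient_map_linear.
HB.instance Definition _ := GRing.isMonoidMorphism.Build R A quotient_map quotient_map_monoid.

End QuotientAlgebra.

(** Spanning gives coordinates modulo [I], freeness makes them unique, and uniqueness makes the
    chosen coordinate function linear. *)
Lemma finite_quotient_algebra (K : fieldType) (R : comAlgType K) (I : R -> Prop)
    (N : nat) (b : 'I_N -> R) :
  (forall p q, I p -> I q -> I (p + q)) -> (forall p q, I q -> I (p * q)) -> ~ I 1 ->
  (forall p, exists c : 'I_N -> K, I (p - \sum_i c i *: b i)) ->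
  (forall c : 'I_N -> K, I (\sum_i c i *: b i) -> forall i, c i = 0) ->
  exists (A : falgType K) (phi : {lrmorphism R -> A}),
    (forall u, exists p, phi p = u) /\ (forall p, phi p = 0 <-> I p).
Proof.
move=> ID IM I1 span free.
have IZ c p : I p -> I (c *: p) by move=> Ip; rewrite -mulr_algl; apply: IM.
have I0 : I 0.
  by have [c /(IM 0)] := span 0; rewrite mul0r.
pose lift (v : 'rV[K]_N) := \sum_i v 0 i *: b i.
have liftD k u v : lift (k *: u + v) = k *: lift u + lift v.
  rewrite /lift scaler_sumr -big_split; apply: eq_bigr => i _.
  by rewrite !mxE scalerDl scalerA.
have lift_inj v : I (lift v) -> v = 0.
  by move=> /free v0; apply/rowP => i; rewrite v0 mxE.
have coord_ex p : exists v, I (p - lift v).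
  have [c hc] := span p; exists (\row_i c i).
  by rewrite /lift; under eq_bigr do rewrite mxE.
pose coord p := proj1_sig (constructive_indefinite_description _ (coord_ex p)).
have coordP p : I (p - lift (coord p)) by rewrite /coord; case: constructive_indefinite_description.
have coord_unique p v : I (p - lift v) -> coord p = v.
  move=> Ipv; apply/eqP; rewrite -subr_eq0; apply/eqP/lift_inj.
  have -> : coord p - v = -1 *: v + coord p by rewrite scaleN1r addrC.
  have -> : lift (-1 *: v + coord p) = (p - lift v) + (-1) *: (p - lift (coord p)).
    by rewrite liftD !scaleN1r; ring.
  by apply: ID => //; apply: IZ.
have coord_linear : linear coord.
  move=> k p q; apply: coord_unique; rewrite liftD.
  have -> : k *: p + q - (k *: lift (coord p) + lift (coord q)) =
      k *: (p - lift (coord p)) + (q - lift (coord q)) by rewrite scalerBr opprD addrACA.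
  by apply: ID => //; apply: IZ.
have lift0 : lift 0 = 0 by rewrite /lift big1 // => i _; rewrite mxE scale0r.
have coord0 p : coord p = 0 <-> I p.
  split=> [p0|Ip]; first by have := coordP p; rewrite p0 lift0 subr0.
  by apply: coord_unique; rewrite lift0 subr0.
have liftK : cancel lift coord by move=> v; apply: coord_unique; rewrite subrr.
have coord_ideal p q : coord q = 0 -> coord (p * q) = 0.
  by move/coord0 => Iq; apply/coord0; apply: IM.
have coord1 : coord 1 != 0 by apply/eqP => /coord0.
pose coordL : {linear R -> 'rV[K]_N} :=
  HB.pack coord (GRing.isLinear.Build K R 'rV[K]_N _ coord coord_linear).
pose Q := @CoordinateQuotient K R N coordL lift liftK coord_ideal coord1.
exists (quotient_space K R N Q), (quotient_map K R N Q); split=> [u|p].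
  by exists (lift u); apply: liftK.
exact: coord0.
Qed.

(** * Jordan types of complete intersections *)

(** The powers of [q] have distinct degrees, so, the ideal being homogeneous, those outside it are
    independent in [A]; there are at most $\dim A$ of them. *)
Lemma linear_form_nilpotent (K : fieldType) (A : falgType K)
    (phi : {lrmorphism {mpoly K[2]} -> A}) (f g q : {mpoly K[2]}) (d m : nat) :
  f \is d.-homog -> g \is m.-homog -> (forall p, phi p = 0 <-> in_ideal2 f g p) ->
  q \is 1.-homog -> exists N, in_ideal2 f g (q ^+ N).
Proof.
move=> hf hg phi_ker hq; pose n := \dim {:A}.
have [z|nz] := eqVneq (phi (q ^+ n)) 0; first by exists n; apply/phi_ker.
have nz_le i : (i <= n)%N -> phi (q ^+ i) != 0.
  move=> le; apply: contraNneq nz => z.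
  by rewrite -(subnK le) exprD rmorphM /= z mulr0.
pose X := [tuple phi (q ^+ (i : 'I_n.+1)) | i < n.+1].
have /eqnP freeX : free X.
  apply/freeP => c c0 i.
  have : phi (\sum_(j < n.+1) c j *: q ^+ j) = 0.
    rewrite -[RHS]c0 linear_sum; apply: eq_bigr => j _.
    by rewrite linearZ -tnth_nth tnth_mktuple.
  move/phi_ker/(in_ideal2_pihomog K f g d m hf hg i)/phi_ker.
  have hqj (j : 'I_n.+1) : q ^+ j \is j.-homog by have := dhomogMn j hq; rewrite mul1n.
  have -> : pihomog mdeg i (\sum_(j < n.+1) c j *: q ^+ j) = c i *: q ^+ i.
    rewrite linear_sum (bigD1 i) //= linearZ /= (pihomog_dE (hqj i)).
    rewrite [X in _ + X]big1 ?addr0 // => j ji.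
    by rewrite linearZ /= (pihomog_ne0 ji (hqj j)) scaler0.
  rewrite linearZ => /eqP; rewrite scaler_eq0 (negbTE (nz_le _ _)) ?orbF; last by rewrite -ltnS.
  by move/eqP.
by have := dimvS (subvf <<X>>); rewrite freeX size_tuple ltnn.
Qed.

Section StairsAndQuotients.
Variables (K : fieldType) (l z : {mpoly K[2]}) (h : 'I_2 -> {poly K}).
Hypothesis lz : linear_coordinates K l z h.
Variables (f g : {mpoly K[2]}) (d m e c : nat) (a : nat -> nat) (n : seq nat).
Hypotheses (hf : f \is d.-homog) (hg : g \is m.-homog).
Local Notation F := (dehomogenize K h f).
Local Notation G := (dehomogenize K h g).
Hypotheses (ed : (e <= d)%N) (dm : (d <= m)%N).
Hypotheses (sF : size F = (d - e).+1) (sGe : (0 < e)%N -> size G = m.+1).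
Hypotheses (a0 : a 0%N = 0%N) (inc : forall i, (i < c)%N -> (a i < a i.+1)%N).
Hypotheses (ac : a c = (d - e)%N) (st : staircase K F (G %% F) c a).
Hypothesis nP : stair_function d m e c a (nth 0%N n).

Let sG : (size G <= m.+1)%N. Proof. exact: size_dehomogenize lz _ _ hg. Qed.

Let low := graded_piece_low K F G d m e c a _ ed dm sF sG sGe a0 inc ac st nP.

Let monic_family : exists Z : nat -> {poly K}, forall r,
  [/\ Z r \is monic, size (Z r) = r.+1 & graded_piece K F G d m (r + nth 0%N n r) (Z r)].
Proof.
have ex := graded_piece_monic K F G d m e c a _ ed dm sF sG sGe a0 inc ac st nP.
exists (fun r => proj1_sig (constructive_indefinite_description _ (ex r))) => r.
by case: constructive_indefinite_description.
Qed.

Lemma stair_jordan_blocks (A : falgType K) (phi : {lrmorphism {mpoly K[2]} -> A}) :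
  (forall u, exists p, phi p = u) -> (forall p, phi p = 0 <-> in_ideal2 f g p) ->
  has_jordan_blocks (amull (phi l)) n.
Proof.
have [Z hZ] := monic_family.
exact: (graded_jordan_blocks K l z h f g d m n Z A phi lz hf hg hZ low).
Qed.

Lemma stair_quotient_exists : (0 < d)%N ->
  exists (A : falgType K) (phi : {lrmorphism {mpoly K[2]} -> A}),
    (forall u, exists p, phi p = u) /\ (forall p, phi p = 0 <-> in_ideal2 f g p).
Proof.
move=> d0; have [Z hZ] := monic_family.
have Zm r : Z r \is monic by case: (hZ r).
have Zs r : size (Z r) = r.+1 by case: (hZ r).
have Zp r : graded_piece K F G d m (r + nth 0%N n r)%N (Z r) by case: (hZ r).
apply: (finite_quotient_algebra K {mpoly K[2]} (in_ideal2 f g) _ (box_form K l z n Z)).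
- exact: in_ideal2D.
- exact: in_ideal2M.
(* Since $0<d\le m$, the ideal has no nonzero part in degree 0, hence does not contain 1. *)
- rewrite -(expr0 l) -(homogenize1 K l z h lz) => /(piece_homogenize K l z h lz f g d m hf hg).
  rewrite size_poly1 => /(_ isT)[u [v [/eqP uv su sv]]]; case/negP: uv.
  have -> : u = 0 by apply/eqP; rewrite -size_poly_eq0; lia.
  have -> : v = 0 by apply/eqP; rewrite -size_poly_eq0; lia.
  by rewrite !mul0r addr0 oner_eq0.
- exact: (box_form_span K l z h lz f g d m hf hg n Z Zm Zs Zp).
- exact: (box_form_free K l z h lz f g d m hf hg n Z Zs low).
Qed.

End StairsAndQuotients.

(** * Passage between complete intersections and staircase partitions *)

Definition stair_partition (P : seq nat) (d m e c : nat) (a : nat -> nat) : Prop :=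
  [/\ (0 < d)%N, (e <= d <= m)%N,
      a 0%N = 0%N /\ (forall i, (i < c)%N -> (a i < a i.+1)%N), a c = (d - e)%N &
      stair_function d m e c a (nth 0%N P)].

Lemma quotient_stair_partition (K : fieldType) (A : falgType K)
    (phi : {lrmorphism {mpoly K[2]} -> A}) (l f g : {mpoly K[2]}) (d m : nat) (P : seq nat) :
  nonincreasing P -> f \is d.-homog -> g \is m.-homog -> (d <= m)%N ->
  (forall u, exists p, phi p = u) -> (forall p, phi p = 0 <-> in_ideal2 f g p) ->
  l \is 1.-homog -> l != 0 -> has_jordan_blocks (amull (phi l)) P ->
  exists e c a, stair_partition P d m e c a.
Proof.
move=> niP hf hg dm phi_surj phi_ker hl l0 jP.
have [z [h lz]] := linear_coordinatesP K l hl l0.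
pose F := dehomogenize K h f; pose G := dehomogenize K h g.
have sF : (size F <= d.+1)%N := size_dehomogenize K l z h lz _ _ hf.
have sG : (size G <= m.+1)%N := size_dehomogenize K l z h lz _ _ hg.
have piece t (w : {poly K}) : (size w <= t.+1)%N ->
    in_ideal2 f g (homogenize K l z t w) -> graded_piece K F G d m t w.
  exact: (piece_homogenize K l z h lz f g d m hf hg).
have no1 : ~ graded_piece K F G d m 0 1.
  move/(homogenize_piece K l z h lz f g d m hf hg).
  by rewrite (homogenize1 K l z h lz) expr0 => /phi_ker/eqP; rewrite rmorph1 oner_eq0.
(* Some $l^N$ lies in the ideal; setting $l=1$ turns this into a Bezout identity. *)
have FGco : coprimep F G.
  have [N] := linear_form_nilpotent K A phi f g l d m hf hg phi_ker hl.
  rewrite -(homogenize1 K l z h lz) => /piece; rewrite size_poly1 => /(_ isT)[u [v [uv _ _]]].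
  by apply/Bezout_eq1_coprimepP; exists (u, v).
(* Some $z^N$ lies in the ideal, so $X^N=uF+vG$ with cofactors of degree at most $N-d$ and $N-m$.
   This is impossible if both $F$ and $G$ drop in degree, that is, if [l] divides both
   generators. *)
have degs : ~~ ((size F <= d) && (size G <= m))%N.
  have [_ hz _ _ _] := lz; apply/negP => /andP[lF lG].
  have [N] := linear_form_nilpotent K A phi f g z d m hf hg phi_ker hz.
  rewrite -(homogenizeX K l z h lz) => /piece; rewrite size_polyXn => /(_ (leqnn _)).
  case=> u [v [uv su sv]]; suff : (size ('X^N : {poly K}) <= N)%N by rewrite size_polyXn ltnn.
  rewrite uv; apply: leq_trans (size_polyD _ _) _; rewrite geq_max; apply/andP; split.
    have [->|u0] := eqVneq u 0; first by rewrite mul0r size_poly0.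
    have su0 : (0 < size u)%N by rewrite size_poly_gt0.
    by apply: leq_trans (size_mulf_leq _ _ _) _; lia.
  have [->|v0] := eqVneq v 0; first by rewrite mul0r size_poly0.
  have sv0 : (0 < size v)%N by rewrite size_poly_gt0.
  by apply: leq_trans (size_mulf_leq _ _ _) _; lia.
(* If $F=0$, then $G$ is a nonzero constant and $m=0$, which would put 1 in the ideal. *)
have F0 : F != 0.
  apply/eqP => F0; move: FGco degs; rewrite F0 coprime0p -size_poly_eq1 size_poly0 /=.
  move=> /eqP sG1; rewrite sG1 -leqNgt leqn0 => /eqP m0; apply: no1.
  have G1 : G = (G`_0)%:P by apply: size1_polyC; rewrite sG1.
  have G00 : G`_0 != 0 by rewrite -polyC_eq0 -G1 -size_poly_eq0 sG1.
  exists 0, (G`_0)^-1%:P; rewrite mul0r add0r size_poly0 {2}G1 -polyCM mulVf //; split=> //.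
  by rewrite m0 size_polyC_leq1.
have d0 : (0 < d)%N.
  rewrite lt0n; apply/eqP => d0; apply: no1.
  have F1 : F = (F`_0)%:P by apply: size1_polyC; rewrite -d0.
  have F00 : F`_0 != 0 by rewrite -polyC_eq0 -F1.
  exists (F`_0)^-1%:P, 0; rewrite mul0r addr0 size_poly0 {2}F1 -polyCM mulVf //; split=> //.
  by rewrite d0 size_polyC_leq1.
have sF0 : (0 < size F)%N by rewrite size_poly_gt0.
(* The drop in degree of $F$, which is the exponent of [l] in [f]; by [degs], $G$ keeps its degree
   when [e] is positive. *)
pose e := (d.+1 - size F)%N.
have ed : (e <= d)%N by rewrite /e; lia.
have sFe : size F = (d - e).+1 by rewrite /e; lia.
have sGe : (0 < e)%N -> size G = m.+1 by rewrite /e => e0; lia.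
have co' : coprimep F (G %% F) by rewrite coprimep_modr.
have [c [a [a0 inc sa st]]] := euclid_staircase K F (G %% F) co' (ltn_modpN0 G F0).
have ac : a c = (d - e)%N by apply/eqP; rewrite -eqSS -sa sFe.
(* The partition predicted by the staircase; uniqueness of Jordan blocks identifies it with [P]. *)
pose n := mkseq (stair_row d m e c a) m.
have sP := stair_row_function _ _ _ _ _ ed dm a0 inc ac.
have nE r : nth 0%N n r = stair_row d m e c a r.
  have [rm|mr] := ltnP r m; first by rewrite nth_mkseq.
  by rewrite nth_default ?size_mkseq //; have [_ _ ->] := sP.
have nP : stair_function d m e c a (nth 0%N n).
  by have [s1 s2 s3] := sP; split=> *; rewrite nE; [apply: s1 | apply: s2 | apply: s3].
have jn := stair_jordan_blocks K l z h lz f g d m e c a n hf hg ed dm sFe sGe a0 inc ac st nP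
  A phi phi_surj phi_ker.
have niN : nonincreasing n.
  by move=> r; apply: (stair_function_nonincreasing _ _ _ _ _ ed dm a0 inc ac _ nP).
have PE r := jordan_blocks_unique K A _ P n niP niN jP jn r.
exists e, c, a; split=> //; first by rewrite ed.
by have [s1 s2 s3] := nP; split=> *; rewrite PE; [apply: s1 | apply: s2 | apply: s3].
Qed.

Lemma CIJT_stair_partition (K : fieldType) (P : seq nat) :
  nonincreasing P -> CIJT K P -> exists d m e c a, stair_partition P d m e c a.
Proof.
move=> niP [A [phi [l [[phi_surj [f [g [m1 [m2 [hf hg phi_ker]]]]]] hl l0 jP]]]].
have [le|/ltnW le] := leqP m1 m2; [exists m1, m2 | exists m2, m1].
  exact: (quotient_stair_partition K A phi l f g).
apply: (quotient_stair_partition K A phi l g f) => // p.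
by rewrite phi_ker; split=> /in_ideal2C.
Qed.

Lemma stair_partition_CIJT (K : fieldType) (P : seq nat) d m e c a :
  stair_partition P d m e c a -> CIJT K P.
Proof.
case=> d0 /andP[ed dm] [a0 inc] ac st.
have [F [G0 [mF sF sG0 co stF]]] := staircase_exists K c a a0 inc.
(* Adding $X^{m-(d-e)}F$ raises the degree to exactly $m$ without changing the remainder modulo
   $F$. *)
rewrite ac in sF; pose G := 'X^(m - (d - e)) * F + G0.
have F0 := monic_neq0 mF.
have sQF : size ('X^(m - (d - e)) * F) = m.+1.
  by rewrite size_monicM ?monicXn // size_polyXn sF; lia.
have sG : size G = m.+1 by rewrite size_polyDl // sQF; move: sG0; rewrite sF; lia.
have GF : G %% F = G0 by rewrite modp_addl_mul_small.
pose l : {mpoly K[2]} := 'X_ord0.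
have hl : l \is 1.-homog by rewrite dhomogX; apply/eqP; exact: mdeg1.
have l0 : l != 0 by apply/eqP => /(congr1 (mcoeff U_(ord0))) /eqP;
  rewrite mcoeffX eqxx mcoeff0 oner_eq0.
have [z [h lz]] := linear_coordinatesP K l hl l0.
pose f := homogenize K l z d F; pose g := homogenize K l z m G.
have hf : f \is d.-homog := homogenize_homog K l z h lz _ _.
have hg : g \is m.-homog := homogenize_homog K l z h lz _ _.
have Df : dehomogenize K h f = F by rewrite (dehomogenizeK K l z h lz) // sF; lia.
have Dg : dehomogenize K h g = G by rewrite (dehomogenizeK K l z h lz) // sG.
have sDf : size (dehomogenize K h f) = (d - e).+1 by rewrite Df.
have sDg : (0 < e)%N -> size (dehomogenize K h g) = m.+1 by rewrite Dg.
have stD : staircase K (dehomogenize K h f) (dehomogenize K h g %% dehomogenize K h f) c a.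
  by rewrite Df Dg GF.
have [A [phi [phi_surj phi_ker]]] := stair_quotient_exists K l z h lz f g d m e c a P
  hf hg ed dm sDf sDg a0 inc ac stD st d0.
exists A, phi, l; split=> //.
  by split=> //; exists f, g, d, m; split.
exact: (stair_jordan_blocks K l z h lz f g d m e c a P hf hg ed dm sDf sDg a0 inc ac stD st).
Qed.

Theorem theorem2p15 (K : fieldType) (d k : nat) (P : seq nat)
    (hd : (2 <= d)%N) (hk : (1 < k)%N)
    (Kinf : infinite_type K)
    (Kchar : [pchar K] =i pred0 \/
             exists2 p : nat, p \in [pchar K] & (2 * d + k - 3 < p)%N)
    (Ppart : is_partition P)
    (PT : has_diagonal_lengths P (Tseq d k)) :
  CIJT K P <->
  exists (e c : nat) (a : nat -> nat),
    [/\ (e <= d)%N,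
        a 0%N = 0%N,
        (forall i, (i < c)%N -> (a i < a i.+1)%N),
        a c = (d - e)%N &
        branch_label d k P =
          map Posz (v_block e ++ 0%N :: flatten [seq h_block d a i | i <- iota 1 c])].
Proof.
have niP := is_partition_nonincreasing _ Ppart.
have d0 : (0 < d)%N by apply: ltnW.
split=> [/(CIJT_stair_partition K P niP)|].
  case=> d' [m' [e [c [a [d'0 /andP[ed dm] [a0 inc] ac st]]]]].
  have [dE mE] := stair_parameters _ _ _ _ _ _ _ _ d0 hk PT d'0 ed dm a0 inc ac st.
  rewrite dE mE in ed ac st; exists e, c, a; split=> //.
  exact: stair_branch_label.
case=> e [c [a [ed a0 inc ac bl]]]; apply: (@stair_partition_CIJT K P d (d + k - 1) e c a).
have sumP := diagonal_sum _ _ _ d0 (ltnW hk) PT.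
split=> //; first by rewrite ed; lia.
exact: (branch_label_stair d k e c a P).
Qed.
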